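(* Let $G=(V,E,\mathcal{P},(V_\Diamond,V_\Box))$ be a weak parity game with $d$ different priorities. Then Zielonka's recursive algorithm solves $G$ (i.e. computes the partition $(W_\Diamond,W_\Box)$ of $V$ into the winning regions of the two players) in time $\mathcal{O}(d\cdot(|V|+|E|))$.
   Context: A parity game $G=(V,E,\mathcal{P},(V_\Diamond,V_\Box))$ consists of a finite vertex set $V$ partitioned into $V_\Diamond$ (owned by player even, $\Diamond$) and $V_\Box$ (owned by player odd, $\Box$), a total edge relation $E\subseteq V\times V$ (every vertex has at least one successor; write $v\to w$ for $(v,w)\in E$) and a priority function $\mathcal{P}:V\to\mathbb{N}$. A token is moved along edges forever, the owner of the current vertex choosing the next vertex; player $\Diamond$ wins an infinite play iff the highest priority occurring infinitely often on it is even. A vertex is won by player $i$ if $i$ has a strategy such that every play from that vertex consistent with it is won by $i$; every vertex is won by exactly one player. Solving $G$ means computing $(W_\Diamond,W_\Box)$, the sets of vertices won by $\Diamond$ and $\Box$. For $A\subseteq V$, $G\cap A$ is the game restricted to vertex set $A$ (edges, priorities, ownership restricted), and $G\setminus A=G\cap(V\setminus A)$. $\overline{i}$ denotes the opponent of $i$. The $i$-attractor of $U\subseteq V$, $\mathit{Attr}_i(U)$, is the union over $n\ge0$ of $\mathit{Attr}^n_i(U)$, where $\mathit{Attr}^0_i(U)=U$ and $\mathit{Attr}^{n+1}_i(U)$ adds to $\mathit{Attr}^n_i(U)$ every vertex of $V_i$ with some successor in $\mathit{Attr}^n_i(U)$ and every vertex of $V_{\overline{i}}$ all of whose successors lie in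 $\mathit{Attr}^n_i(U)$. Zielonka's algorithm $\textsc{Zielonka}(G)$: if $V=\emptyset$ return $(\emptyset,\emptyset)$. Otherwise let $m$ be the maximal priority in $G$, $p=\Diamond$ if $m$ is even and $p=\Box$ otherwise, $U=\{v\in V\mid \mathcal{P}(v)=m\}$, $A=\mathit{Attr}_p(U)$, and $(W'_\Diamond,W'_\Box)=\textsc{Zielonka}(G\setminus A)$ (first recursive call). If $W'_{\overline p}=\emptyset$, return $W_p=A\cup W'_p$, $W_{\overline p}=\emptyset$. Otherwise let $B=\mathit{Attr}_{\overline p}(W'_{\overline p})$, $(W''_\Diamond,W''_\Box)=\textsc{Zielonka}(G\setminus B)$ (second recursive call), and return $W_p=W''_p$, $W_{\overline p}=W''_{\overline p}\cup B$. A parity game is weak if for every edge $v\to w$ we have $\mathcal{P}(v)\ge\mathcal{P}(w)$ (priorities are non-increasing along all paths). *)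

(* Defs.v *)
From mathcomp Require Import all_boot.
Set Implicit Arguments.
Unset Strict Implicit.
Unset Printing Implicit Defensive.

Definition player := bool.
Definition diamond : player := true.
Definition box : player := false.
Definition opponent (i : player) : player := ~~ i.
Definition parity_player (m : nat) : player := if odd m then box else diamond.

Record parity_game := ParityGame {
  vertex :> finType;
  edge : rel vertex;
  edge_total : forall v, exists w, edge v w;
  priority : vertex -> nat;
  owner : vertex -> player }.

Section Winning.
Variable G : parity_game.

(* A strategy maps the nonempty history of the play (last element: the current
   vertex) to the next vertex; it has to propose an edge whenever its player
   is to move. *)
Definition legal_strategy (i : player) (sigma : seq G -> G) : Prop :=
  forall (h : seq G) (v : G), owner v = i -> edge v (sigma (rcons h v)).

Definition is_play (v : G) (pi : nat -> G) : Prop :=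
  pi 0 = v /\ forall n, edge (pi n) (pi n.+1).

Definition consistent (i : player) (sigma : seq G -> G) (pi : nat -> G) : Prop :=
  forall n, owner (pi n) = i -> pi n.+1 = sigma (mkseq pi n.+1).

Definition inf_often (pi : nat -> G) (m : nat) : Prop :=
  forall n, exists2 k, n <= k & priority (pi k) = m.

Definition play_won (i : player) (pi : nat -> G) : Prop :=
  exists m, [/\ inf_often pi m,
                forall m', inf_often pi m' -> m' <= m
              & parity_player m = i].

Definition won_by (i : player) (v : G) : Prop :=
  exists2 sigma, legal_strategy i sigma &
    forall pi, is_play v pi -> consistent i sigma pi -> play_won i pi.

Definition weak : Prop := forall v w : G, edge v w -> priority w <= priority v.

Definition num_priorities : nat := size (undup (codom (@priority G))).
Definition num_edges : nat := #|[pred e : G * G | edge e.1 e.2]|.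

End Winning.

(* In this section a set of vertices [H] stands for the subgame of [G]
   restricted to [H]. *)
Section Zielonka.
Variable G : parity_game.
Implicit Types (H U X : {set G}) (i : player).

Definition attr_step i H X : {set G} :=
  X :|: [set v in H | if owner v == i then [exists w in H, edge v w && (w \in X)]
                      else [forall w in H, edge v w ==> (w \in X)]].

(* The chain of the iterates is stationary from index #|G| on. *)
Definition attr i H U : {set G} :=
  \bigcup_(n < #|G|.+1) iter n (attr_step i H) U.

(* The result maps each player to the vertices it wins. The argument [n] bounds
   the recursion depth; it is never exhausted when [#|H| <= n], because [A] and
   [B] are nonempty. *)
Fixpoint zielonka_rec (n : nat) (H : {set G}) : player -> {set G} :=
  if n is n'.+1 then
    if H == set0 then fun=> set0 else
    let m := \max_(v in H) priority v in
    let p := parity_player m in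
    let q := opponent p in
    let A := attr p H [set v in H | priority v == m] in
    let W' := zielonka_rec n' (H :\: A) in
    if W' q == set0 then fun i => if i == p then A :|: W' p else set0
    else
      let B := attr q H (W' q) in
      let W'' := zielonka_rec n' (H :\: B) in
      fun i => if i == p then W'' p else W'' q :|: B
  else fun=> set0.

Definition zielonka : player -> {set G} := zielonka_rec #|G| setT.

End Zielonka.

(* A step-counting implementation of the same algorithm.

   The machine has arrays indexed by the vertices (the fields of [memory],
   accessed with unit cost by [get] / [put] / ...) and immutable linked lists.
   The clock is advanced by [tick] on every (recursive) call of every
   procedure, and a call does, apart from the calls it makes, a bounded number
   of elementary operations: array accesses, list cell operations, comparisons
   of vertices, players or priorities, parity tests. The successor and predecessor lists are
   the adjacency lists of the game. *)

(* [Out]: not in the current subgame; [Free]: in the current subgame, not yet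
   assigned to a player; [Won i]: in the current subgame, assigned to [i]. *)
Definition cell := option (option player).
Definition Out : cell := None.
Definition Free : cell := Some None.
Definition Won (i : player) : cell := Some (Some i).

Section Implementation.
Variable G : parity_game.

Definition succs (v : G) : seq G := enum [pred w | edge v w].
Definition preds (v : G) : seq G := enum [pred u | edge u v].

Record memory := Memory {
  status : {ffun G -> cell};
  pending : {ffun G -> seq G};
  clock : nat }.

(* [None] means that a loop or recursion ran out of its fuel. *)
Definition M (T : Type) := memory -> option (T * memory).

Definition ret T (x : T) : M T := fun s => Some (x, s).
Definition fail T : M T := fun=> None.
Definition bind T T' (c : M T) (k : T -> M T') : M T' :=
  fun s => if c s is Some (x, s') then k x s' else None.

Definition ticks (n : nat) : M unit :=
  fun s => Some (tt, Memory (status s) (pending s) (clock s + n)).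
Definition tick : M unit := ticks 1.
Definition get (v : G) : M cell := fun s => Some (status s v, s).
Definition put (v : G) (c : cell) : M unit := fun s =>
  Some (tt, Memory [ffun w => if w == v then c else status s w]
                   (pending s) (clock s)).
Definition get_pending (v : G) : M (seq G) := fun s => Some (pending s v, s).
Definition put_pending (v : G) (l : seq G) : M unit := fun s =>
  Some (tt, Memory (status s)
                   [ffun w => if w == v then l else pending s w] (clock s)).

Local Notation "'let*' x ':=' c 'in' k" := (bind c (fun x => k))
  (at level 200, x name, c at level 200, k at level 200, right associativity).
Local Notation "c ;; k" := (bind c (fun=> k))
  (at level 199, k at level 200, right associativity).

(* The longest suffix of [l] whose first vertex has status [c]. *)
Fixpoint seek (c : cell) (l : seq G) : M (seq G) :=
  tick;;
  if l is v :: l' then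
    let* c' := get v in
    if c' == c then ret l else seek c l'
  else ret [::].

Fixpoint put_all (c : cell) (l : seq G) : M unit :=
  tick;;
  if l is v :: l' then put v c;; put_all c l' else ret tt.

Fixpoint reset_pending (l : seq G) : M unit :=
  tick;;
  if l is v :: l' then put_pending v (succs v);; reset_pending l' else ret tt.

Fixpoint push (l work : seq G) : M (seq G) :=
  tick;;
  if l is v :: l' then push l' (v :: work) else ret work.

Fixpoint push_preds (l work : seq G) : M (seq G) :=
  tick;;
  if l is v :: l' then
    let* work' := push (preds v) work in push_preds l' work'
  else ret work.

(* Extends the set of vertices with status [Won i] to its [i]-attractor by
   vertices with status [a]: backward search, where [work] lists the vertices
   to examine. It has to include every vertex that is attracted in the first
   step; predecessors of attracted vertices are added on the way. A vertex of
   the opponent is attracted once none of its successors has status [a]; the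
   successors not yet known to have lost that status are kept in [pending], so
   that its successor list is traversed only once. Returns the attracted
   vertices, added to [acc]; [touched] lists the vertices whose [pending] entry
   has to be restored. At most #|G| + num_edges G vertices are examined: each
   attracted vertex contributes its predecessors once. *)
Fixpoint attract_loop (fuel : nat) (i : player) (a : cell)
    (work acc touched : seq G) : M (seq G) :=
  if fuel is fuel'.+1 then
    tick;;
    if work is v :: work' then
      let* c := get v in
      if c != a then attract_loop fuel' i a work' acc touched
      else if owner v == i then
        let* l := seek (Won i) (succs v) in
        if l is _ :: _ then
          put v (Won i);;
          let* work'' := push (preds v) work' in
          attract_loop fuel' i a work'' (v :: acc) touched
        else attract_loop fuel' i a work' acc touched
      else
        let* l0 := get_pending v in
        let* l := seek a l0 in
        put_pending v l;;
        if l is _ :: _ then attract_loop fuel' i a work' acc (v :: touched)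
        else
          put v (Won i);;
          let* work'' := push (preds v) work' in
          attract_loop fuel' i a work'' (v :: acc) (v :: touched)
    else reset_pending touched;; ret acc
  else @fail _.

Definition attract (i : player) (a : cell) (work acc : seq G) : M (seq G) :=
  attract_loop (#|G| + num_edges G).+1 i a work acc [::].

(* Assigns to [p] the free vertices of the leading block of priority [m]. *)
Fixpoint take_top (m : nat) (p : player) (l acc : seq G) : M (seq G * seq G) :=
  tick;;
  if l is v :: l' then
    if priority v == m then
      let* c := get v in
      if c == Free then put v (Won p);; take_top m p l' (v :: acc)
      else take_top m p l' acc
    else ret (acc, l)
  else ret (acc, l).

(* Frees the vertices assigned to [p] and takes those assigned to the opponent
   out of the current subgame. *)
Fixpoint reopen (p : player) (l : seq G) : M (seq G * seq G) :=
  tick;;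
  if l is v :: l' then
    let* c := get v in
    if c == Won p then
      put v Free;; let* r := reopen p l' in ret (v :: r.1, r.2)
    else if c == Won (opponent p) then
      put v Out;; let* r := reopen p l' in ret (r.1, v :: r.2)
    else reopen p l'
  else ret ([::], [::]).

(* Precondition: the current subgame is the set of the vertices with status
   [Free], all other vertices have status [Out], and [l] is sorted by
   decreasing priority and contains every free vertex once (possibly among
   others). Afterwards each vertex of the subgame has status [Won] of its
   winner; the result tells for each player whether it wins some vertex.

   [A], [W'] and [B] are those of the algorithm; the vertices of [A] have
   status [Out] during the first recursive call. As no vertex outside [A] is
   attracted to [W' q] in one step, [A] suffices as initial work list for [B].
   If nothing remains assigned to [p], the second subgame is empty. *)
Fixpoint solve (fuel : nat) (l : seq G) : M (player -> bool) :=
  if fuel is fuel'.+1 then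
    tick;;
    let* l0 := seek Free l in
    if l0 is x :: _ then
      let m := priority x in
      let p := parity_player m in
      let q := opponent p in
      let* top := take_top m p l0 [::] in
      let* work := push_preds top.1 [::] in
      let* A := attract p Free work top.1 in
      put_all Out A;;
      let* W' := solve fuel' top.2 in
      put_all (Won p) A;;
      if ~~ W' q then ret (fun i => i == p)
      else
        attract q (Won p) A [::];;
        let* restA := seek (Won p) A in
        let* sub := if W' p || (restA != [::]) then reopen p l0
                    else ret ([::], [::]) in
        let* W'' := solve fuel' sub.1 in
        put_all (Won q) sub.2;;
        ret (fun i => if i == p then W'' p else true)
    else ret (fun=> false)
  else @fail _.

(* Buckets of vertices of equal priority, in order of decreasing priority. *)
Fixpoint insert_bucket (v : G) (bs : seq (nat * seq G)) : M (seq (nat * seq G)) :=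
  tick;;
  if bs is b :: bs' then
    if priority v == b.1 then ret ((b.1, v :: b.2) :: bs')
    else if b.1 < priority v then ret ((priority v, [:: v]) :: bs)
    else let* r := insert_bucket v bs' in ret (b :: r)
  else ret [:: (priority v, [:: v])].

Fixpoint make_buckets (l : seq G) (bs : seq (nat * seq G)) :
    M (seq (nat * seq G)) :=
  tick;;
  if l is v :: l' then
    let* bs' := insert_bucket v bs in make_buckets l' bs'
  else ret bs.

Fixpoint append (l1 l2 : seq G) : M (seq G) :=
  tick;;
  if l1 is v :: l1' then let* r := append l1' l2 in ret (v :: r) else ret l2.

Fixpoint concat (bs : seq (nat * seq G)) : M (seq G) :=
  tick;;
  if bs is b :: bs' then let* r := concat bs' in append b.2 r else ret [::].

Definition main : M unit :=
  (* allocation of the arrays and of the adjacency lists *)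
  ticks (#|G| + num_edges G);;
  let* bs := make_buckets (enum G) [::] in
  let* l := concat bs in
  solve #|G|.+1 l;;
  ret tt.

Definition initial_memory : memory :=
  Memory [ffun=> Free] [ffun v => succs v] 0.

(* The sets of vertices assigned to the players and the number of steps. *)
Definition run_zielonka : option ((player -> {set G}) * nat) :=
  if main initial_memory is Some (_, s) then
    Some (fun i => [set v | status s v == Won i], clock s)
  else None.

End Implementation.

(* Main.v *)
(* Call a set of vertices an i-dominion if it carries a rank function and moves
   of i, staying inside the set, along which the rank decreases whenever the
   priority is constant and of the wrong parity; the opponent cannot leave it.
   In a weak game plays eventually have constant priority, so that i wins from
   an i-dominion, and dominions of the two players are disjoint. Both Zielonka's
   algorithm and the program compute a partition into two dominions, hence the
   same one.

   For the running time: since no edge leads to a higher priority, the vertices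
   U of maximal priority form their own attractor. So the first recursive call
   has one priority less, and the second subgame, consisting of vertices of U
   and of vertices won by p in the first call, is won entirely by p. On a game
   won entirely by one player there is no second recursive call on a nonempty
   subgame, and every vertex and edge is paid for only at the level that removes
   it; such a game is solved in linear time. In general the cost is therefore
   linear at each of the at most d levels of first recursive calls. *)

Require Import Defs.
From mathcomp Require Import all_boot.
From mathcomp Require Import zify.
From Stdlib Require Import Classical_Prop.

Set Implicit Arguments.
Unset Strict Implicit.
Unset Printing Implicit Defensive.

Lemma opponentK : involutive opponent.
Proof. exact: negbK. Qed.

Lemma opponentP (i j : player) : i <> j -> i = opponent j.
Proof. by case: i; case: j. Qed.

Lemma opponent_neq (i : player) : (opponent i == i) = false.
Proof. by case: i. Qed.

(** * Dominions *)

Section Dominions.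
Variable G : parity_game.
Implicit Types (i j p : player) (H U Z X B W S : {set G}) (r : G -> nat) (v w : G).

(** In a weak game the priority changes only finitely often along a play, so a change of priority
    counts as progress by itself; the rank has to decrease only while a priority unfavourable to [i]
    persists. *)
Definition progress i r v w : bool :=
  [|| parity_player (priority v) == i, priority w != priority v | r w < r v].

(** A local certificate that [i] wins from [Z] in the subgame [H]. Only opponent moves staying in
    [H] are constrained, so a dominion of a subgame need not be one of the whole game. *)
Definition dominion i H Z : Prop := exists r : G -> nat,
  [/\ Z \subset H,
      forall v, v \in Z -> owner v = i ->
        exists w, [/\ edge v w, w \in Z & progress i r v w]
    & forall v w, v \in Z -> owner v <> i -> w \in H -> edge v w ->
        w \in Z /\ progress i r v w].

Definition total_on H : Prop :=
  forall v, v \in H -> exists2 w, w \in H & edge v w.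

(** Disjointness of the two sets comes from [dominion_disjoint] when the game is weak. Covering is
    stated for each [p] so that either player can be named first. *)
Definition solution H (Z : player -> {set G}) : Prop :=
  (forall i, dominion i H (Z i)) /\
  (forall p v, v \in H -> (v \in Z p) || (v \in Z (opponent p))).

Lemma dominion_sub i H Z : dominion i H Z -> Z \subset H.
Proof. by case=> r []. Qed.

Lemma dominion0 i H : dominion i H set0.
Proof. by exists (fun=> 0); split=> [|v|v w]; rewrite ?sub0set ?inE. Qed.

(** The ranks outside [B] are shifted above all ranks on [B]. Then entering [B] always decreases the
    rank, while comparisons inside [B] and among the remaining vertices are unchanged. *)
Lemma dominion_extend i H B W r :
    dominion i H B -> W \subset H ->
    (forall v, v \in W -> owner v = i ->
       exists w, [/\ edge v w, w \in B :|: W & (w \in B) || progress i r v w]) ->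
    (forall v w, v \in W -> owner v <> i -> w \in H -> edge v w ->
       w \in B :|: W /\ (w \in B) || progress i r v w) ->
  dominion i H (B :|: W).
Proof.
case=> rB [BH domB domB'] WH domW domW'.
pose M := \max_(v in B) rB v.
pose r' v := if v \in B then rB v else r v + M.+1.
have r'B v w : v \in B -> w \in B -> progress i rB v w -> progress i r' v w.
  by rewrite /progress /r' => -> ->.
have r'W v w : v \notin B -> (w \in B) || progress i r v w -> progress i r' v w.
  rewrite /progress /r' => /negPf ->; case: ifP => [wB _|_ /=].
    suff -> : rB w < r v + M.+1 by rewrite !orbT.
    by rewrite addnS ltnS (leq_trans _ (leq_addl _ _)) // leq_bigmax_cond.
  by rewrite ltn_add2r.
exists r'; split; first by rewrite subUset BH.
- move=> v vBW own; have [vB|vNB] := boolP (v \in B).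
    have [w [vw wB pr]] := domB v vB own.
    by exists w; rewrite inE wB; split=> //; apply: r'B.
  move: vBW; rewrite inE (negPf vNB) /= => vW.
  have [w [vw wBW pr]] := domW v vW own.
  by exists w; split=> //; apply: r'W.
move=> v w vBW own wH vw; have [vB|vNB] := boolP (v \in B).
  have [wB pr] := domB' v w vB own wH vw.
  by rewrite inE wB; split=> //; apply: r'B.
move: vBW; rewrite inE (negPf vNB) /= => vW.
by have [wBW pr] := domW' v w vW own wH vw; split=> //; apply: r'W.
Qed.

Lemma dominion_attract i H B S :
    dominion i H B -> S \subset H ->
    (forall v, v \in S -> owner v = i -> exists2 w, w \in B & edge v w) ->
    (forall v w, v \in S -> owner v <> i -> w \in H -> edge v w -> w \in B) ->
  dominion i H (B :|: S).
Proof.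
move=> domB SH att att'; apply: (@dominion_extend _ _ _ _ (fun=> 0)) => //.
  by move=> v vS own; have [w wB vw] := att v vS own; exists w; rewrite inE wB.
by move=> v w vS own wH vw; rewrite inE (att' v w).
Qed.

(** The opponent can leave [W] within [H] only by entering [B], which is progress in the combined
    certificate. *)
Lemma dominion_union i H B W :
  dominion i H B -> dominion i (H :\: B) W -> dominion i H (B :|: W).
Proof.
move=> domB [r [WH domW domW']]; apply: (@dominion_extend _ _ _ _ r) => //.
- exact: subset_trans WH (subsetDl _ _).
- move=> v vW own; have [w [vw wW pr]] := domW v vW own.
  by exists w; rewrite inE wW pr !orbT.
move=> v w vW own wH vw; rewrite inE; case wB: (w \in B) => //=.
by have [] := domW' v w vW own _ vw; rewrite ?inE ?wB.
Qed.

Lemma dominion_widen i H H' Z :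
    H' \subset H -> dominion i H' Z ->
    (forall v w, v \in Z -> owner v <> i -> w \in H -> edge v w -> w \in H') ->
  dominion i H Z.
Proof.
move=> H'H [r [ZH dom dom']] closed; exists r; split=> //.
  exact: subset_trans ZH H'H.
by move=> v w vZ own wH vw; apply: dom' => //; apply: closed vw.
Qed.

(* In a vertex common to both dominions the owner's certificate provides a move
   into both, which makes progress for both players; so the priority, and then
   the rank of the player to whom this priority is unfavourable, descend
   forever. *)
Lemma dominion_disjoint i H Z Z' v :
  weak G -> dominion i H Z -> dominion (opponent i) H Z' ->
  v \in Z -> v \notin Z'.
Proof.
move=> wk [r [ZH dom dom']] [r' [Z'H domo domo']] vZ; apply/negP => vZ'.
have step u : u \in Z -> u \in Z' -> exists w,
    [/\ edge u w, w \in Z, w \in Z' & progress i r u w && progress (opponent i) r' u w].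
  move=> uZ uZ'; have [own|own] := eqVneq (owner u) i.
    have [w [uw wZ pr]] := dom u uZ own; exists w.
    have [|wZ' pr'] := domo' u w uZ' _ (subsetP ZH _ wZ) uw.
      by rewrite own; case: (i).
    by rewrite pr pr'; split.
  have own' : owner u = opponent i by apply/opponentP/eqP.
  have [w [uw wZ' pr']] := domo u uZ' own'; exists w.
  have [|wZ pr] := dom' u w uZ _ (subsetP Z'H _ wZ') uw; first exact/eqP.
  by rewrite pr pr'; split.
have vI : v \in Z :&: Z' by rewrite inE vZ.
pose u := [arg min_(u < v in Z :&: Z') priority u].
have [uI umin] : u \in Z :&: Z' /\ forall w, w \in Z :&: Z' -> priority u <= priority w.
  by rewrite /u; case: arg_minnP.
pose R := if parity_player (priority u) == i then r' else r.
pose D := [set w in Z :&: Z' | priority w == priority u].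
have uD : u \in D by rewrite inE uI eqxx.
pose x := [arg min_(x < u in D) R x].
have [xD xmin] : x \in D /\ forall w, w \in D -> R x <= R w.
  by rewrite /x; case: arg_minnP.
move: xD; rewrite !inE => /andP[/andP[xZ xZ'] /eqP prx].
have [w [xw wZ wZ' pr]] := step x xZ xZ'.
have prw : priority w = priority u.
  by apply/eqP; rewrite eqn_leq umin ?inE ?wZ // -prx wk.
have /xmin : w \in D by rewrite !inE wZ wZ' prw eqxx.
move: pr; rewrite /progress prx prw eqxx /= /R.
case: eqP => [->|_] /=; last by case/andP=> lt_r _; rewrite leqNgt lt_r.
by rewrite eq_sym opponent_neq /= => lt_r; rewrite leqNgt lt_r.
Qed.

(** A vertex given to [i] by one solution is covered by the other, where by [dominion_disjoint] it
    cannot belong to the opponent. *)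
Lemma solution_unique H (Z Z' : player -> {set G}) :
  weak G -> solution H Z -> solution H Z' -> Z =1 Z'.
Proof.
move=> wk sol sol' i; apply/eqP; rewrite eqEsubset.
have sub (Y Y' : player -> {set G}) : solution H Y -> solution H Y' ->
    Y i \subset Y' i.
  move=> [domY _] [domY' coverY']; apply/subsetP => v vY.
  have /coverY' : v \in H by apply: subsetP vY; apply: dominion_sub.
  by move/(_ i); rewrite (negPf (dominion_disjoint wk (domY i) (domY' _) vY)) orbF.
by rewrite !sub.
Qed.

Lemma solution0 : solution set0 (fun=> set0).
Proof. by split=> [i|p v]; [apply: dominion0 | rewrite inE]. Qed.

(** * The block of highest priority and the assembly of solutions *)

Definition top_block H m : Prop := forall v, v \in H -> priority v <= m.

Lemma top_block_closed H m v w :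
    weak G -> top_block H m -> v \in H :\: [set v in H | priority v == m] ->
    w \in H -> edge v w ->
  w \in H :\: [set v in H | priority v == m].
Proof.
move=> wk top; rewrite !inE => /andP[vm vH] wH vw; rewrite wH andbT /=.
have:= top v vH; have := wk v w vw; move: vm; rewrite vH /=; lia.
Qed.

Lemma dominion_below i H m Z :
    weak G -> top_block H m ->
    dominion i (H :\: [set v in H | priority v == m]) Z ->
  dominion i H Z.
Proof.
move=> wk top dom; apply: (dominion_widen _ dom); first exact: subsetDl.
move=> v w vZ _; apply: top_block_closed => //.
by apply: subsetP vZ; apply: dominion_sub dom.
Qed.

(** At priority [m] every edge is progress for its parity player, so totality of [H'] supplies the
    moves there; below [m] the certificate of [W] is reused. It serves both for [H] itself and for
    the second subgame [H :\: B]. *)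
Lemma dominion_top H H' m W :
    weak G -> top_block H m -> H' \subset H -> total_on H' ->
    dominion (parity_player m) (H :\: [set v in H | priority v == m]) W ->
    H' \subset [set v in H | priority v == m] :|: W -> W \subset H' ->
  dominion (parity_player m) H' H'.
Proof.
move=> wk top H'H tot [r [WH dom dom']] H'U WH'; exists r; split=> //.
  move=> v vH' own; have := subsetP H'U v vH'; rewrite !inE.
  case: eqP => [prv _|_]; last rewrite andbF /= => vW.
    by have [w wH' vw] := tot v vH'; exists w; rewrite /progress prv eqxx.
  by have [w [vw wW pr]] := dom v vW own; exists w; rewrite (subsetP WH').
move=> v w vH' own wH' vw; split=> //; have := subsetP H'U v vH'; rewrite !inE.
case: eqP => [prv _|_]; last rewrite andbF /= => vW.
  by rewrite /progress prv eqxx.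
suff /(dom' v w vW own): w \in H :\: [set v in H | priority v == m].
  by case/(_ vw).
by apply: (top_block_closed wk top _ _ vw); apply: subsetP; eassumption.
Qed.

Lemma solution_top H m (Z : player -> {set G}) :
    weak G -> top_block H m -> total_on H ->
    solution (H :\: [set v in H | priority v == m]) Z ->
    Z (opponent (parity_player m)) = set0 ->
  solution H (fun i => if i == parity_player m
                       then [set v in H | priority v == m] :|: Z (parity_player m)
                       else set0).
Proof.
set U := [set v in H | _]; set p := parity_player m.
move=> wk top tot [dom cover] Zq.
have UZ : U :|: Z p = H.
  apply/setP => v; rewrite in_setU.
  case: (boolP (v \in U)) => vU /=; first by move: vU; rewrite inE => /andP[->].
  apply/idP/idP => vH.
    have /subsetP/(_ v vH) := dominion_sub (dom p).
    by rewrite inE => /andP[].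
  by have := cover p v; rewrite Zq in_set0 orbF; apply; rewrite in_setD vU.
split=> [i|i v vH]; last first.
  by rewrite UZ; case: (i); case: (p); rewrite /= vH ?orbT.
case: eqP => [->|_]; last exact: dominion0.
rewrite UZ; apply: (dominion_top wk top _ tot (dom p)) => //.
  by rewrite UZ.
exact: subset_trans (dominion_sub (dom p)) (subsetDl _ _).
Qed.

(** This assembles the result of the second recursive call. The opponent's dominion joins [B] by
    [dominion_union]; the one of [p] survives in [H] because the opponent has no edge from outside
    into [B]. *)
Lemma solution_attr H B p (Z : player -> {set G}) :
    dominion (opponent p) H B ->
    (forall v w, v \in H :\: B -> owner v <> p -> w \in B -> ~~ edge v w) ->
    solution (H :\: B) Z ->
  solution H (fun i => if i == p then Z p else Z (opponent p) :|: B).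
Proof.
move=> domB closed [dom cover]; split=> [i|i v vH].
  case: eqP => [->|/opponentP ->]; last by rewrite setUC; apply: dominion_union.
  apply: dominion_widen (subsetDl _ _) (dom p) _ => v w vZ own wH vw.
  have vHB := subsetP (dominion_sub (dom p)) v vZ.
  by rewrite inE wH andbT; apply: contraL vw; apply: closed.
suff: (v \in Z p) || (v \in Z (opponent p) :|: B).
  have [->|/eqP/opponentP ->] := eqVneq i p; first by rewrite opponent_neq.
  by rewrite opponentK eqxx orbC.
rewrite in_setU; have [_|vB] := boolP (v \in B); first by rewrite !orbT.
by rewrite orbF cover // inE vB.
Qed.

(** * Attractors as fixed points *)

Lemma attr_step_sub i H X : X \subset attr_step i H X.
Proof. exact: subsetUl. Qed.

Lemma iter_attr_step_sub i H U k n :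
  k <= n -> iter k (attr_step i H) U \subset iter n (attr_step i H) U.
Proof.
elim: n => [|n IHn]; first by rewrite leqn0 => /eqP ->.
rewrite leq_eqVlt => /predU1P[->//|]; rewrite ltnS => /IHn /subset_trans; apply.
exact: attr_step_sub.
Qed.

Lemma attrE i H U : attr i H U = iter #|G| (attr_step i H) U.
Proof.
apply/eqP; rewrite eqEsubset; apply/andP; split.
  by apply/bigcupsP => k _; apply: iter_attr_step_sub; rewrite -ltnS ltn_ord.
exact: (bigcup_max (ord_max : 'I_#|G|.+1)).
Qed.

(** If no iterate up to index [#|G|] were stationary, each step would add a vertex, and the next
    iterate would have more than [#|G|] elements. *)
Lemma attr_fixed i H U : attr_step i H (attr i H U) = attr i H U.
Proof.
rewrite attrE; set F := attr_step i H.
case: (classic (exists2 k, k <= #|G| & F (iter k F U) = iter k F U)).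
  case=> k kG Fk; have fixed n : iter (n + k) F U = iter k F U.
    by elim: n => // n IHn; rewrite addSn iterS IHn.
  by rewrite -(subnK kG) fixed.
move=> noFix; have card_iter n : n <= #|G|.+1 -> n <= #|iter n F U|.
  elim: n => // n IHn nG; apply: leq_ltn_trans (IHn (ltnW nG)) _.
  apply: proper_card; rewrite properEneq attr_step_sub andbT.
  by apply/eqP => eqF; apply: noFix; exists n; rewrite // -eqF.
by have := leq_trans (card_iter _ (leqnn _)) (max_card _); rewrite ltnn.
Qed.

Lemma sub_attr i H U : U \subset attr i H U.
Proof. by rewrite attrE (@iter_attr_step_sub _ _ _ 0). Qed.

Lemma attr_sub i H U : U \subset H -> attr i H U \subset H.
Proof.
rewrite attrE => UH; elim: #|_| => // n IHn; rewrite iterS subUset IHn /=.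
by apply/subsetP => v; rewrite inE => /andP[].
Qed.

Lemma dominion_attr i H U : dominion i H U -> dominion i H (attr i H U).
Proof.
rewrite attrE => domU; elim: #|_| => // n IHn; rewrite iterS.
apply: dominion_attract => //.
- by apply/subsetP => v; rewrite inE => /andP[].
- move=> v; rewrite inE => /andP[vH] + own; rewrite own eqxx.
  by case/existsP=> w /and3P[_ vw wX]; exists w.
move=> v w; rewrite inE => /andP[vH] + /eqP/negPf own; rewrite own.
by move=> /forallP/(_ w)/implyP att wH vw; move: (att wH); rewrite vw.
Qed.

Lemma attrP i H U v : v \in H -> v \notin attr i H U ->
  if owner v == i then forall w, w \in H -> w \in attr i H U -> ~~ edge v w
  else exists w, [/\ w \in H, edge v w & w \notin attr i H U].
Proof.
move=> vH; rewrite -{1}attr_fixed inE negb_or inE vH /= => /andP[_].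
case: ifP => _.
  rewrite negb_exists => /forallP att w wH wA; apply/negP => vw.
  by have := att w; rewrite wH vw wA.
rewrite negb_forall => /existsP[w]; rewrite !negb_imply => /and3P[wH vw wA].
by exists w.
Qed.

Lemma total_on_attr i H U : total_on H -> total_on (H :\: attr i H U).
Proof.
move=> tot v; rewrite inE => /andP[vA vH].
have := attrP vH vA; case: ifP => _ => [att|[w [wH vw wA]]]; last first.
  by exists w => //; rewrite inE wA.
have [w wH vw] := tot v vH; exists w => //; rewrite inE wH andbT.
by apply/negP => wA; have := att w wH wA; rewrite vw.
Qed.

(* Vertices below the top block have no edges into it. *)
Lemma attr_top i H m :
    weak G -> top_block H m -> total_on H ->
  attr i H [set v in H | priority v == m] = [set v in H | priority v == m].
Proof.
set U := [set v in H | _] => wk top tot.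
suff step : attr_step i H U = U by rewrite attrE; elim: #|_| => //= n ->.
apply/setUidPl/subsetP => v; rewrite inE => /andP[vH att].
apply/negPn/negP => vU; have below w : w \in H -> edge v w -> w \notin U.
  move=> wH vw; have: v \in H :\: U by rewrite inE vU.
  by move=> /(top_block_closed wk top)/(_ wH vw); rewrite inE => /andP[].
move: att; case: ifP => _; first by case/existsP=> w /and3P[wH vw wU]; have:= below w wH vw; rewrite wU.
have [w wH vw] := tot v vH => /forallP/(_ w)/implyP/(_ wH).
by rewrite vw /= (negPf (below w wH vw)).
Qed.

(** * Correctness of the recursive algorithm *)

Lemma max_top_block H : top_block H (\max_(v in H) priority v).
Proof. by move=> v vH; apply: (@leq_bigmax_cond _ (fun v => v \in H) (@priority G)). Qed.

(** Since the top block is its own attractor, the first call solves [H :\: U]; then [solution_top]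
    or [solution_attr] assembles the answer. *)
Lemma solution_zielonka_rec n H :
  weak G -> total_on H -> #|H| <= n -> solution H (zielonka_rec n H).
Proof.
move=> wk; elim: n H => [|n IHn] H tot /=.
  by rewrite leqn0 cards_eq0 => /eqP ->; apply: solution0.
case: eqP => [-> _|/eqP Hn0 Hn]; first exact: solution0.
have top := max_top_block (H := H); move: top.
set m := \max_(v in H) priority v => top.
(* Removing a nonempty set lowers the cardinality, so the recursion bound [n] is enough for both
   calls. *)
have rec S : S \subset H -> S != set0 -> total_on (H :\: S) ->
    solution (H :\: S) (zielonka_rec n (H :\: S)).
  move=> SH Sn0 totS; apply: IHn => //; rewrite -ltnS (leq_trans _ Hn) //.
  by apply: proper_card; rewrite setDE properEneq subsetIl andbT -setDE;
     apply: contra Sn0 => /eqP/setDidPl; rewrite disjoint_sym -setI_eq0 (setIidPl SH).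
set U := [set v in H | priority v == m]; set p := parity_player m.
have UH : U \subset H by apply/subsetP => v; rewrite inE => /andP[].
have Un0 : U != set0.
  case/set0Pn: Hn0 => v vH; have [u uH um] : {u | u \in H & m = priority u}.
    by apply: eq_bigmax_cond; apply/card_gt0P; exists v.
  by apply/set0Pn; exists u; rewrite inE uH um eqxx.
have := total_on_attr (i := p) (U := U) tot; rewrite attr_top // -/U => totU.
have sol := rec U UH Un0 totU.
case: eqP => [Wq0|/eqP Wqn0]; first exact: solution_top.
set Wq := zielonka_rec n (H :\: U) _; set q := opponent p.
have domW : dominion q H Wq by apply: (dominion_below wk top); apply: sol.1.
apply: (solution_attr (dominion_attr domW)).
  move=> v w; rewrite inE => /andP[vA vH] /opponentP own wA.
  have := attrP vH vA; rewrite own eqxx; apply=> //.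
  by apply: subsetP wA; apply/attr_sub/dominion_sub/domW.
apply: rec; last exact: total_on_attr.
  exact/attr_sub/dominion_sub/domW.
by apply: contraNneq Wqn0 => B0; rewrite -subset0 -B0 sub_attr.
Qed.

Lemma total_on_setT : total_on [set: G].
Proof. by move=> v _; have [w vw] := edge_total v; exists w. Qed.

Lemma solution_zielonka : weak G -> solution setT (zielonka G).
Proof.
by move=> wk; apply: solution_zielonka_rec (total_on_setT) _; rewrite ?cardsT.
Qed.

End Dominions.

(** * Plays and strategies *)

Section Plays.
Variable G : parity_game.
Implicit Types (i : player) (v w : G) (pi : nat -> G).

(** Priorities never increase along the play, so each strict drop lowers the bound [b] of the
    induction; once there is no further drop they are constant. *)
Lemma eventually_constant_priority v pi : weak G -> is_play v pi ->
  exists N, forall n, N <= n -> priority (pi n) = priority (pi N).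
Proof.
move=> wk [_ play].
have mono k n : k <= n -> priority (pi n) <= priority (pi k).
  elim: n => [|n IHn]; first by rewrite leqn0 => /eqP ->.
  by rewrite leq_eqVlt => /predU1P[->//|/IHn]; apply/leq_trans/wk/play.
suff: forall b N, priority (pi N) <= b ->
    exists N', forall n, N' <= n -> priority (pi n) = priority (pi N').
  by apply; apply: (leqnn (priority (pi 0))).
elim=> [|b IHb] N leb.
  exists N => n /mono; move: leb; lia.
have [[n Nn lt]|stable] :=
    classic (exists2 n, N <= n & priority (pi n) < priority (pi N)).
  by apply: (IHb n); rewrite -ltnS (leq_trans lt).
exists N => n Nn; apply/eqP; rewrite eqn_leq mono //= leqNgt.
by apply/negP => lt; apply: stable; exists n.
Qed.

Lemma play_won_unique i j pi : play_won i pi -> play_won j pi -> i = j.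
Proof.
move=> [m [om maxm <-]] [m' [om' maxm' <-]]; congr parity_player.
by apply/eqP; rewrite eqn_leq maxm' ?maxm.
Qed.

Lemma dominion_won i Z v : weak G -> dominion i setT Z -> v \in Z -> won_by i v.
Proof.
move=> wk [r [_ dom dom']] vZ.
(* The strategy is positional. Where the certificate offers no move an arbitrary successor is taken,
   so that the strategy is legal on all histories. *)
pose move u := if [pick w in Z | edge u w && progress i r u w] is Some w then w
               else xchoose (edge_total u).
pose sigma (h : seq G) := move (last v h).
exists sigma => [h u _|pi play cons].
  rewrite /sigma last_rcons /move; case: pickP => [w /and3P[_ ->]//|_].
  exact: xchooseP.
have [pi0 edges] := play.
have piZ n : pi n \in Z /\ progress i r (pi n) (pi n.+1).
  suff step u w : u \in Z -> edge u w -> (owner u = i -> w = move u) ->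
      w \in Z /\ progress i r u w.
    have piZ : pi n \in Z.
      elim: n => [|n IHn]; first by rewrite pi0.
      have [] // := step _ _ IHn (edges n) => own.
      by rewrite cons // /sigma mkseqS last_rcons.
    split=> //; apply: (step _ _ piZ (edges n) _).2 => own.
    by rewrite cons // /sigma mkseqS last_rcons.
  move=> uZ uw own; have [owni|owni] := eqVneq (owner u) i; last first.
    by apply: dom' => //; apply/eqP.
  have [x [ux xZ pr]] := dom u uZ owni; rewrite own // /move.
  case: pickP => [y /and3P[] //|/(_ x)].
  by rewrite xZ ux pr.
have [N const] := eventually_constant_priority wk play.
exists (priority (pi N)); split.
- move=> n; exists (maxn n N); rewrite ?leq_maxl // const //.
  exact: leq_maxr.
- by move=> m /(_ N)[k Nk <-]; rewrite const.
apply/eqP/negPn/negP => wrong.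
(* While an unfavourable priority persists every step lowers the rank, which cannot go on
   forever. *)
suff: forall n, r (pi (N + n)) + n <= r (pi N).
  by move/(_ (r (pi N)).+1); lia.
have constN k : priority (pi (N + k)) = priority (pi N) by rewrite const ?leq_addr.
elim=> [|n IHn]; first by rewrite !addn0.
have [_] := piZ (N + n); rewrite /progress -addnS !constN eqxx (negPf wrong) /=.
by lia.
Qed.

(** For distinct players, the two winning strategies played against each other would yield one play
    won by both. *)
Lemma won_by_unique i j v : won_by i v -> won_by j v -> i = j.
Proof.
move=> [s legs wins] [s' legs' wins']; have [//|neq] := eqVneq i j.
pose next (h : seq G) := if owner (last v h) == i then s h else s' h.
(* The histories are built first, since the strategies depend on them; [pi] reads off their last
   vertices. *)
pose hist n := iter n (fun h => rcons h (next h)) [:: v].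
pose pi n := last v (hist n).
have histE n : mkseq pi n.+1 = hist n.
  elim: n => // n IHn.
  by rewrite mkseqS IHn /pi /= last_rcons.
have histR n : hist n = rcons (mkseq pi n) (pi n) by rewrite -mkseqS histE.
have piS n : pi n.+1 = next (hist n) by rewrite /pi /= last_rcons.
have play : is_play v pi.
  split=> // n; rewrite piS /next -/(pi n).
  case: eqP => [own|/opponentP own]; rewrite histR; first exact: legs.
  by apply: legs'; rewrite own; move: neq; case: (i); case: (j).
apply: (@play_won_unique i j pi).
  by apply: wins => // n own; rewrite histE piS /next -/(pi n) own eqxx.
apply: wins' => // n own; rewrite histE piS /next -/(pi n) own.
by rewrite eq_sym (negPf neq).
Qed.

End Plays.

Lemma zielonka_correct (G : parity_game) i (v : G) :
  weak G -> v \in zielonka G i <-> won_by i v.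
Proof.
move=> wk; have [dom cover] := solution_zielonka wk; split.
  exact: dominion_won (dom i).
(* A vertex won by [i] but not returned for [i] would lie in the opponent's dominion and be won by
   both players. *)
move=> win; have /orP[//|vZ] := cover i v (in_setT v).
have /(won_by_unique win) := dominion_won wk (dom _) vZ.
by case: (i).
Qed.

Lemma zielonka_cover (G : parity_game) :
  weak G -> zielonka G diamond :|: zielonka G box = [set: G].
Proof.
move=> wk; have [_ cover] := solution_zielonka wk.
by apply/setP => v; rewrite !inE (cover diamond) ?inE.
Qed.

Lemma zielonka_disjoint (G : parity_game) :
  weak G -> zielonka G diamond :&: zielonka G box = set0.
Proof.
move=> wk; have [dom _] := solution_zielonka wk.
apply/setP => v; rewrite in_set0 in_setI; apply/andP => -[vd].
by apply/negP; apply: (dominion_disjoint wk (dom diamond) (dom box)).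
Qed.

(** * Running time *)

Section Machine.
Variable G : parity_game.
Implicit Types (i p : player) (a c : cell) (v w : G) (l work acc touched : seq G).
Implicit Types (s : memory G) (U H : {set G}).

(** * Effect and cost of the elementary list procedures *)

Definition elapse n s : memory G := Memory (status s) (pending s) (clock s + n).

Lemma bindE T T' (c : M G T) (k : T -> M G T') s x s' :
  c s = Some (x, s') -> bind c k s = k x s'.
Proof. by rewrite /bind => ->. Qed.

Lemma mem_preds v w : (v \in preds w) = edge v w.
Proof. by rewrite mem_enum inE. Qed.

Lemma mem_succs v w : (w \in succs v) = edge v w.
Proof. by rewrite mem_enum inE. Qed.

(** When the search fails, [find] returns the length of [l]; so the same formula gives the empty
    result, and its last tick is that of the empty list. *)
Lemma seekE c l s :
  let k := find (fun v => status s v == c) l in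
  seek c l s = Some (drop k l, elapse k.+1 s).
Proof.
elim: l s => [|v l IHl] s /=; first by [].
rewrite /bind /tick /ticks /get /=; case: ifP => _; first by [].
by rewrite IHl /elapse /=; congr (Some (_, Memory _ _ _)); lia.
Qed.

Lemma put_allE c l s :
  put_all c l s = Some (tt, Memory [ffun w => if w \in l then c else status s w]
                                   (pending s) (clock s + (size l).+1)).
Proof.
elim: l s => [|v l IHl] s /=.
  rewrite /bind /tick /ticks /ret /=; congr (Some (_, Memory _ _ _)).
  by apply/ffunP => w; rewrite ffunE.
rewrite /bind /tick /ticks /= IHl /=; congr (Some (_, Memory _ _ _)); last by lia.
apply/ffunP => w; rewrite !ffunE inE; case: (w \in l); first by rewrite orbT.
by rewrite orbF.
Qed.

Lemma reset_pendingE l s :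
  reset_pending l s =
    Some (tt, Memory (status s)
                     [ffun w => if w \in l then succs w else pending s w]
                     (clock s + (size l).+1)).
Proof.
elim: l s => [|v l IHl] s /=.
  rewrite /bind /tick /ticks /ret /=; congr (Some (_, Memory _ _ _)).
  by apply/ffunP => w; rewrite ffunE.
rewrite /bind /tick /ticks /= IHl /=; congr (Some (_, Memory _ _ _)); last by lia.
apply/ffunP => w; rewrite !ffunE inE; case: (w \in l); first by rewrite orbT.
by rewrite orbF; case: eqP => [->|].
Qed.

Lemma pushE l work s : push l work s = Some (catrev l work, elapse (size l).+1 s).
Proof.
elim: l work s => [|v l IHl] work s /=; first by [].
by rewrite /bind /tick /ticks /= IHl /elapse /=; congr (Some (_, Memory _ _ _)); lia.
Qed.

Lemma push_predsE l work s :
  push_preds l work s =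
    Some (foldl (fun work v => catrev (preds v) work) work l,
          elapse (\sum_(v <- l) (size (preds v)).+2).+1 s).
Proof.
elim: l work s => [|v l IHl] work s /=; first by rewrite big_nil.
rewrite /bind /tick /ticks /= pushE IHl /elapse /= big_cons.
by congr (Some (_, Memory _ _ _)); lia.
Qed.

Lemma mem_push_preds l work v :
  (v \in foldl (fun work v => catrev (preds v) work) work l) =
  has (edge v) l || (v \in work).
Proof.
elim: l work => //= w l IHl work.
by rewrite IHl catrevE mem_cat mem_rev mem_preds orbA [has _ _ || _]orbC.
Qed.

Lemma size_push_preds l work :
  size (foldl (fun work v => catrev (preds v) work) work l) =
  \sum_(v <- l) size (preds v) + size work.
Proof.
elim: l work => /= [|w l IHl] work; first by rewrite big_nil.
by rewrite IHl catrevE size_cat size_rev big_cons; lia.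
Qed.

(** Needed for the first attractor, where the work list has no free vertex: the loop only discards
    entries. The two extra ticks belong to the final call and to [reset_pending] on the empty
    list. *)
Lemma attract_loop_idle fuel i a work acc s :
  (forall v, v \in work -> status s v != a) -> size work < fuel ->
  attract_loop fuel i a work acc [::] s = Some (acc, elapse (size work).+2 s).
Proof.
elim: fuel work s => // fuel IHf [|v work] s idle /=.
  by rewrite /bind /tick /ticks /= /elapse -addnA.
rewrite ltnS => size_f; rewrite /bind /tick /ticks /get /= idle ?mem_head //=.
rewrite IHf //=; last by move=> w wwork; rewrite /= idle // inE wwork orbT.
by rewrite /elapse /=; congr (Some (_, Memory _ _ _)); lia.
Qed.

(** * The attractor computation: invariant, potential and correctness *)

Section Attraction.
Variables (i : player) (a : cell) (U H : {set G}).
Hypothesis aNi : a != Won i.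
Implicit Types (st : {ffun G -> cell}) (pd : {ffun G -> seq G}).

Definition won_succ st v := [exists w, edge v w && (st w == Won i)].

Definition attractable st v :=
  if owner v == i then won_succ st v
  else ~~ [exists w, edge v w && (st w == a)].

(** [U] confines the vertices that can be attracted, and [inv_closed] keeps pushed predecessors of
    status [a] inside it. With an empty work list [inv_complete] says that the attractor is closed.
    By [inv_lost], an exhausted pending list proves that no successor has status [a]. *)
Record attract_inv st pd work touched : Prop := AttractInv {
  inv_work : forall v, v \in work -> st v = a -> v \in U;
  inv_closed : forall v w, w \in U -> edge v w -> st v = a -> v \in U;
  inv_complete : forall v, st v = a -> attractable st v -> v \in work;
  inv_pending : forall v w, w \in pd v -> edge v w;
  inv_lost : forall v w, edge v w -> st w = a -> w \in pd v;
  inv_touched : forall v, v \notin touched -> pd v = succs v;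
  inv_status : forall v, v \in H -> st v = a \/ st v = Won i;
  inv_game : forall v, st v = a -> v \in H;
  inv_dominion : dominion i H [set v | st v == Won i] }.

(* Examining a vertex of [i] in vain traverses its successor list; this is
   charged to the entry of the work list, and cannot happen to an entry that was
   pushed because of an attracted successor. *)
Definition entry_cost st v := 3 + (if won_succ st v then 0 else size (succs v)).

(** A potential bounding the remaining steps. A vertex of [U] not yet attracted reserves 4 per
    predecessor: one for the push, 3 for the new entry. Pending lists pay for their traversal,
    [touched] for the restoration, and 2 covers the closing ticks. *)
Definition attract_cost st pd work touched :=
  \sum_(v <- work) entry_cost st v
  + \sum_(v in U | st v == a) (size (succs v) + 4 * size (preds v) + 3)
  + \sum_(v in U) size (pd v) + size touched + 2.

(** Each iteration lowers this by one: an attracted vertex exchanges its predecessors in the sum for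
    as many new entries. *)
Definition attract_fuel st work :=
  size work + \sum_(v in U | st v == a) size (preds v).

Definition capture st v : {ffun G -> cell} :=
  [ffun w => if w == v then Won i else st w].

Definition set_pending pd v l : {ffun G -> seq G} :=
  [ffun w => if w == v then l else pd w].

Lemma captureE st v w : (capture st v w == a) = (w != v) && (st w == a).
Proof.
by rewrite ffunE; case: (w == v) => //; apply/negbTE; rewrite eq_sym.
Qed.

Lemma pop_inv st pd v work touched :
  attract_inv st pd (v :: work) touched -> ~ (st v = a /\ attractable st v) ->
  attract_inv st pd work touched.
Proof.
case=> workU closed complete pend lost touch stat game dom nov; split=> //.
  by move=> u uw; apply: workU; rewrite inE uw orbT.
move=> u ua att; have:= complete u ua att; rewrite inE => /predU1P[eq_u|//].
by case: nov; rewrite -eq_u.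
Qed.

Lemma pending_inv st pd v work touched k :
    attract_inv st pd work touched ->
    (forall w, w \in take k (pd v) -> st w != a) ->
  attract_inv st (set_pending pd v (drop k (pd v))) work (v :: touched).
Proof.
case=> workU closed complete pend lost touch stat game dom lostk; split=> //.
- move=> u w; rewrite ffunE; case: eqP => [->|_]; last exact: pend.
  by move/mem_drop; apply: pend.
- move=> u w uw wa; rewrite ffunE; case: eqP => [eq_u|_]; last exact: lost.
  rewrite eq_u in uw; have:= lost v w uw wa.
  by rewrite -{1}(cat_take_drop k (pd v)) mem_cat => /orP[/lostk|//]; rewrite wa eqxx.
by move=> u; rewrite inE negb_or ffunE => /andP[/negPf-> /touch].
Qed.

Lemma won_succ_capture st v u : won_succ st u -> won_succ (capture st v) u.
Proof.
move=> /existsP[w /andP[uw wi]]; apply/existsP; exists w.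
by rewrite uw ffunE; case: ifP; rewrite ?eqxx.
Qed.

Lemma won_succ_new st v u : edge u v -> won_succ (capture st v) u.
Proof. by move=> uv; apply/existsP; exists v; rewrite uv ffunE !eqxx. Qed.

(** Only predecessors of [v] can become attractable, and they are pushed. If the opponent owns [v],
    [inv_status] shows that all successors of [v] in [H] are already won, so [dominion_attract]
    applies. *)
Lemma capture_inv st pd v work touched :
    attract_inv st pd (v :: work) touched -> st v = a -> attractable st v ->
  attract_inv (capture st v) pd (catrev (preds v) work) touched.
Proof.
case=> workU closed complete pend lost touch stat game dom va att.
have captured u : capture st v u = a -> u != v /\ st u = a.
  by move/eqP; rewrite captureE => /andP[? /eqP].
have vU : v \in U by apply: workU; rewrite ?mem_head.
split=> //.
- move=> u; rewrite catrevE mem_cat mem_rev mem_preds => uw /captured[_ ua].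
  by case/orP: uw => [/closed|uw]; [apply | apply: workU; rewrite // inE uw orbT].
- by move=> u w wU uw /captured[_]; apply: closed uw.
- move=> u /captured[uv ua] attu; rewrite catrevE mem_cat mem_rev mem_preds.
  have [//|Nuv] := boolP (edge u v).
  suff /(complete u ua) : attractable st u by rewrite inE (negPf uv).
  move: attu; rewrite /attractable; case: ifP => _.
    case/existsP=> w /andP[uw]; rewrite ffunE; have [eq_w _|_ wi] := eqVneq w v.
      by rewrite -eq_w uw in Nuv.
    by apply/existsP; exists w; rewrite uw.
  apply: contra => /existsP[w /andP[uw wa]]; apply/existsP; exists w.
  by rewrite uw captureE wa andbT /=; apply: contraNneq Nuv => <-.
- by move=> u w uw /captured[_]; apply: lost.
- move=> u uH; rewrite ffunE; case: ifP => _; [by right | exact: stat].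
- by move=> u /captured[_]; apply: game.
have -> : [set u | capture st v u == Won i] = [set u | st u == Won i] :|: [set v].
  by apply/setP => u; rewrite !inE ffunE orbC; case: (u == v) => //=; rewrite eqxx.
apply: dominion_attract => //; first by rewrite sub1set game.
  move=> u; rewrite inE => /eqP -> /eqP own; move: att; rewrite /attractable own.
  by case/existsP=> w /andP[vw wi]; exists w; rewrite ?inE.
move=> u w; rewrite inE => /eqP -> /eqP/negPf own wH vw; rewrite inE.
move: att; rewrite /attractable own negb_exists => /forallP/(_ w).
by rewrite vw /=; case: (stat w wH) => ->; rewrite eqxx.
Qed.

Lemma pop_cost st pd v work touched :
  attract_cost st pd (v :: work) touched =
  entry_cost st v + attract_cost st pd work touched.
Proof. by rewrite /attract_cost big_cons !addnA. Qed.

Lemma pending_cost st pd v work touched k : v \in U -> k <= size (pd v) ->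
  attract_cost st (set_pending pd v (drop k (pd v))) work (v :: touched) + k =
  (attract_cost st pd work touched).+1.
Proof.
move=> vU lek; rewrite /attract_cost /=.
suff : \sum_(w in U) size (set_pending pd v (drop k (pd v)) w) + k =
       \sum_(w in U) size (pd w) by lia.
rewrite (bigD1 v) //= [RHS](bigD1 v) //= ffunE eqxx size_drop.
under eq_bigr => w /andP[_ /negPf wv] do rewrite ffunE wv.
by lia.
Qed.

Lemma capture_sum st v (F : G -> nat) : v \in U -> st v = a ->
  \sum_(w in U | st w == a) F w =
  F v + \sum_(w in U | capture st v w == a) F w.
Proof.
move=> vU va; rewrite (bigD1 v) /=; last by rewrite vU va eqxx.
congr (_ + _); apply: eq_bigl => w.
by rewrite captureE andbAC andbA.
Qed.

(** The new entries cost only 3 each, since their successor [v] is now won, and no old entry becomes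
    dearer; the rest of the reserve of [v] is released. *)
Lemma capture_cost st pd v work touched : v \in U -> st v = a ->
  attract_cost (capture st v) pd (catrev (preds v) work) touched
    + (size (succs v) + size (preds v) + 3) <=
  attract_cost st pd work touched.
Proof.
move=> vU va; rewrite /attract_cost (capture_sum _ vU va) catrevE big_cat big_rev /=.
have -> : \sum_(u <- preds v) entry_cost (capture st v) u = 3 * size (preds v).
  rewrite (eq_big_seq (fun=> 3)) => [|u]; last first.
    by rewrite mem_preds /entry_cost => /won_succ_new ->.
  by rewrite big_const_seq count_predT iter_addn addn0.
have : \sum_(u <- work) entry_cost (capture st v) u <= \sum_(u <- work) entry_cost st u.
  apply: leq_sum => u _; rewrite /entry_cost leq_add2l.
  by case: ifP => // lose; case: ifP => // /(won_succ_capture v); rewrite lose.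
lia.
Qed.

Lemma capture_fuel st v work : v \in U -> st v = a ->
  attract_fuel (capture st v) (catrev (preds v) work) = attract_fuel st work.
Proof.
move=> vU va; rewrite /attract_fuel (capture_sum _ vU va).
by rewrite catrevE size_cat size_rev; lia.
Qed.

Lemma attract_loopP fuel work acc touched s :
    attract_inv (status s) (pending s) work touched ->
    attract_fuel (status s) work < fuel ->
  exists acc' s', [/\ attract_loop fuel i a work acc touched s = Some (acc', s'),
    attract_inv (status s') (pending s') [::] [::],
    (forall v, status s' v = status s v \/
               [/\ v \in U, status s v = a & status s' v = Won i])
  & clock s' <= clock s + attract_cost (status s) (pending s) work touched].
Proof.
elim: fuel work acc touched s => // fuel IHf [|v work] acc touched s inv lt_fuel /=.
  rewrite {1}/bind /tick /ticks /= (bindE _ (reset_pendingE _ _)) /ret /=.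
  eexists _, _; split; first by [].
  - case: inv => workU closed complete pend lost touch stat game dom; split=> //= u.
    + by move=> w; rewrite ffunE; case: ifP => _; [rewrite mem_succs | apply: pend].
    + by move=> w uw wa; rewrite ffunE; case: ifP => _; [rewrite mem_succs | apply: lost].
    + by rewrite ffunE => _; case: ifP => // /negbT/touch.
  - by left.
  by rewrite /= /attract_cost; lia.
(* The slack in the clock bound is left for what precedes the capture: the tick, the search and the
   growth of [touched]. *)
have captureP acc1 touched1 s1 :
    attract_inv (status s1) (pending s1) (v :: work) touched1 ->
    status s1 = status s -> status s v = a -> attractable (status s) v ->
    v \in U ->
  exists acc' s', [/\
    bind (put v (Won i)) (fun=> bind (push (preds v) work) (fun work' =>
      attract_loop fuel i a work' acc1 touched1)) s1 = Some (acc', s'),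
    attract_inv (status s') (pending s') [::] [::],
    (forall u, status s' u = status s u \/
               [/\ u \in U, status s u = a & status s' u = Won i])
  & clock s' + size (succs v) + 5 <=
    clock s1 + attract_cost (status s1) (pending s1) (v :: work) touched1].
  move=> inv1 st1 va att vU; rewrite {1}/bind /put (bindE _ (pushE _ _ _)).
  rewrite st1 in inv1 *.
  have [||acc' [s' [-> inv' st' cl]]] := IHf (catrev (preds v) work) acc1 touched1
    (elapse (size (preds v)).+1 (Memory (capture (status s) v) (pending s1) (clock s1))).
  - exact: capture_inv inv1 va att.
  - by rewrite /= capture_fuel.
  exists acc', s'; split=> // [u|].
    have [->|[uU]] := st' u; rewrite /= ffunE; case: eqP => [->|_]; by [left|right].
  by have := capture_cost (pending s1) work touched1 vU va; move: cl; rewrite pop_cost /entry_cost /=; lia.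
have skipP touched1 s1 :
    attract_inv (status s1) (pending s1) work touched1 ->
    status s1 = status s ->
  exists acc' s', [/\ attract_loop fuel i a work acc touched1 s1 = Some (acc', s'),
    attract_inv (status s') (pending s') [::] [::],
    (forall u, status s' u = status s u \/
               [/\ u \in U, status s u = a & status s' u = Won i])
  & clock s' <= clock s1 + attract_cost (status s1) (pending s1) work touched1].
  by move=> inv1 st1; rewrite -st1; apply: IHf => //; rewrite st1.
rewrite {1}/bind /tick /ticks /= {1}/bind /get /=.
have [va|vNa] /= := eqVneq (status s v) a; last first.
  have [||acc' [s' [-> inv' st' cl]]] := skipP touched (elapse 1 s) => //.
    by apply: pop_inv inv _ => -[va]; rewrite va eqxx in vNa.
  exists acc', s'; split=> //; apply: leq_trans cl _.
  by rewrite pop_cost /entry_cost /=; lia.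
have vU : v \in U by apply: (inv_work inv) va; rewrite mem_head.
have [own|own] := eqVneq (owner v) i.
  rewrite (bindE _ (seekE _ _ _)) /=.
  set k := find _ _.
  have lek : k <= size (succs v) by apply: find_size.
  case dk: (drop k (succs v)) => [|x l].
    have nowin : won_succ (status s) v = false.
      apply/negbTE/negP => /existsP[w /andP[vw wi]].
      have : k < size (succs v).
        by rewrite -has_find; apply/hasP; exists w; rewrite ?mem_succs.
      by rewrite ltnNge -subn_eq0 -size_drop dk.
    have [||acc' [s' [-> inv' st' cl]]] := skipP touched (elapse k.+1 (elapse 1 s)) => //.
      by apply: pop_inv inv _ => -[_]; rewrite /attractable own eqxx nowin.
    exists acc', s'; split=> //; apply: leq_trans cl _.
    by rewrite pop_cost /entry_cost nowin /=; lia.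
  have [|||||acc' [s' [-> inv' st' cl]]] :=
    captureP (v :: acc) touched (elapse k.+1 (elapse 1 s)) => //.
    rewrite /attractable own eqxx; apply/existsP; exists x.
    have hask : has (fun w => status s w == Won i) (succs v).
      by rewrite has_find ltnNge -subn_eq0 -size_drop -/k dk.
    have := nth_find v hask; rewrite -/k -[k]addn0 -nth_drop dk /= => ->.
    by rewrite -mem_succs -(cat_take_drop k (succs v)) dk mem_cat mem_head orbT.
  exists acc', s'; split=> //; move: cl => /=; lia.
rewrite {1}/bind /get_pending /= (bindE _ (seekE _ _ _)) /=.
set k := find _ _.
have lek : k <= size (pending s v) by apply: find_size.
have lost_k w : w \in take k (pending s v) -> status s w != a.
  move=> wk; apply/negP => wa; suff: k < k by rewrite ltnn.
  by apply: find_ltn; apply/hasP; exists w.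
have inv1 := pending_inv inv lost_k.
have := pending_cost (status s) (v :: work) touched vU lek.
rewrite {1}/bind /put_pending /= -/(set_pending (pending s) v (drop k (pending s v))).
set pd1 := set_pending _ _ _ => cost1.
case dk: (drop k (pending s v)) => [|x l].
  have [|||||acc' [s' [-> inv' st' cl]]] :=
    captureP (v :: acc) (v :: touched) (Memory (status s) pd1 (clock s + 1 + k.+1)) => //.
    rewrite /attractable (negPf own) negb_exists; apply/forallP => w.
    apply/negP => /andP[vw /eqP wa]; have := inv_lost inv1 vw wa.
    by rewrite ffunE eqxx dk.
  exists acc', s'; split=> //; move: cl cost1 => /=; lia.
have [||acc' [s' [-> inv' st' cl]]] :=
  skipP (v :: touched) (Memory (status s) pd1 (clock s + 1 + k.+1)) => //.
  apply: pop_inv inv1 _ => -[_]; rewrite /attractable (negPf own) => /existsP[].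
  exists x; have hask : has (fun w => status s w == a) (pending s v).
    by rewrite has_find ltnNge -subn_eq0 -size_drop -/k dk.
  have := nth_find v hask; rewrite -/k -[k]addn0 -nth_drop dk /= => ->.
  rewrite andbT; apply: (inv_pending inv).
  by rewrite -(cat_take_drop k (pending s v)) dk mem_cat mem_head orbT.
(* The 3 units of the entry are used up here: by the call, the last tick of [seek] and the longer
   [touched]. *)
exists acc', s'; split=> //; move: cl cost1; rewrite pop_cost /entry_cost /=; lia.
Qed.

End Attraction.

(** * Splitting the vertex list by priority and by status *)

Lemma take_topE m p l acc s :
  let k := find (fun v => priority v != m) l in
  uniq l -> (forall v, v \in l -> status s v = Free) ->
  take_top m p l acc s =
    Some ((catrev (take k l) acc, drop k l),
          Memory [ffun w => if w \in take k l then Won p else status s w]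
                 (pending s) (clock s + k.+1)).
Proof.
have same s1 : [ffun w => status s1 w] = status s1 by apply/ffunP => w; rewrite ffunE.
elim: l acc s => [|v l IHl] acc s /=.
  by move=> _ _; rewrite /bind /tick /ticks /ret /= same.
move=> /andP[vl ul] freel; rewrite /bind /tick /ticks /=.
case: ifP => prv /=; last by rewrite /ret /= same.
rewrite /get /= freel ?mem_head //= /put /= IHl //=; last first.
  move=> w wl; rewrite ffunE /= freel ?inE ?wl ?orbT //.
  by case: eqP => // eq_w; rewrite -eq_w wl in vl.
congr (Some (_, Memory _ _ _)); last by lia.
apply/ffunP => w; rewrite !ffunE inE.
by case: (w \in take _ _); rewrite ?orbT ?orbF.
Qed.

Lemma reopenE p l s : uniq l ->
  reopen p l s =
    Some (([seq v <- l | status s v == Won p],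
           [seq v <- l | status s v == Won (opponent p)]),
          Memory [ffun w => if w \notin l then status s w
                            else if status s w == Won p then Free
                            else if status s w == Won (opponent p) then Out
                            else status s w]
                 (pending s) (clock s + (size l).+1)).
Proof.
elim: l s => [|v l IHl] s /=.
  move=> _; rewrite /bind /tick /ticks /ret /=; congr (Some (_, Memory _ _ _)).
  by apply/ffunP => w; rewrite ffunE.
move=> /andP[vl ul]; rewrite /bind /tick /ticks /get /=.
have put_filter c i : [seq w <- l | [ffun u => if u == v then c else status s u] w == Won i]
    = [seq w <- l | status s w == Won i].
  apply: eq_in_filter => w wl; rewrite ffunE; case: (eqVneq w v) => // eq_w.
  by rewrite -eq_w wl in vl.
case: ifP => stp.
  have -> : (status s v == Won (opponent p)) = false.
    by rewrite (eqP stp); case: (p).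
  rewrite /put IHl //= /ret !put_filter; congr (Some (_, Memory _ _ _)); last by lia.
  apply/ffunP => w; rewrite !ffunE inE; have [->|] := eqVneq w v; last by [].
  by rewrite vl stp.
case: ifP => stq.
  rewrite /put IHl //= /ret !put_filter; congr (Some (_, Memory _ _ _)); last by lia.
  apply/ffunP => w; rewrite !ffunE inE; have [->|] := eqVneq w v; last by [].
  by rewrite vl stp stq.
rewrite IHl //=; congr (Some (_, Memory _ _ _)); last by lia.
apply/ffunP => w; rewrite !ffunE inE; have [->|] := eqVneq w v; last by [].
by rewrite vl stp stq.
Qed.

(** * Weights, priority counts and edge counts *)

Definition degree v := (size (succs v) + size (preds v)).+1.

Definition weight l := \sum_(v <- l) degree v.

Definition priority_count l := size (undup [seq priority v | v <- l]).

Definition decreasing l := pairwise (fun u v => priority v <= priority u) l.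

Lemma size_weight l : size l + \sum_(v <- l) size (succs v) + \sum_(v <- l) size (preds v)
  = weight l.
Proof.
rewrite /weight; elim: l => [|v l IHl]; first by rewrite !big_nil.
by rewrite !big_cons -IHl /degree /=; lia.
Qed.

Lemma weight_filter (P : pred G) l :
  weight [seq v <- l | P v] + weight [seq v <- l | ~~ P v] = weight l.
Proof. by rewrite /weight !big_filter [RHS](bigID P). Qed.

(** In a sorted list the vertices of the maximal priority form a prefix, so one scan splits it. *)
Lemma find_decreasing m l :
    decreasing l -> (forall v, v \in l -> priority v <= m) ->
  let k := find (fun v => priority v != m) l in
  take k l = [seq v <- l | priority v == m] /\ drop k l = [seq v <- l | priority v != m].
Proof.
elim: l => //= v l IHl /andP[/allP lev dec] lem.
have [prv|prv] /= := eqVneq (priority v) m.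
  have [|-> ->] := IHl dec; last by [].
  by move=> w wl; apply: lem; rewrite inE wl orbT.
have below w : w \in l -> priority w != m.
  by move=> wl; have := lem v (mem_head _ _); move: prv (lev w wl); lia.
rewrite (eq_in_filter (a2 := pred0)) ?filter_pred0; last by move=> w /below/negPf.
rewrite (eq_in_filter (a2 := predT)) ?filter_predT //.
Qed.

Lemma priority_count_top m l x : x \in l -> priority x = m ->
  priority_count l = (priority_count [seq v <- l | priority v != m]).+1.
Proof.
move=> xl prx; rewrite /priority_count -[RHS]/(size (m :: _)).
apply/perm_size/uniq_perm; rewrite ?undup_uniq //=.
  rewrite undup_uniq andbT mem_undup; apply/mapP => -[v].
  by rewrite mem_filter => /andP[+ _] eq_m; rewrite -eq_m eqxx.
move=> n; rewrite inE !mem_undup; apply/mapP/predU1P.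
  case=> v vl ->; have [->|prv] := eqVneq (priority v) m; first by left.
  by right; apply/mapP; exists v; rewrite ?mem_filter ?prv.
case=> [->|/mapP[v]]; first by exists x.
by rewrite mem_filter => /andP[_ vl] ->; exists v.
Qed.

Lemma num_edges_sum : \sum_v size (@preds G v) = num_edges G.
Proof.
rewrite /num_edges -sum1_card (eq_bigl (fun e : G * G => predT e.1 && edge e.1 e.2)) //.
rewrite -(pair_big_dep predT (fun u v : G => edge u v) (fun _ _ => 1)) /=.
rewrite (exchange_big_dep predT) //=; apply: eq_bigr => v _.
by rewrite sum1_card /preds -cardE.
Qed.

Lemma num_edges_sum_succs : \sum_v size (@succs G v) = num_edges G.
Proof.
rewrite /num_edges -sum1_card (eq_bigl (fun e : G * G => predT e.1 && edge e.1 e.2)) //.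
rewrite -(pair_big_dep predT (fun u v : G => edge u v) (fun _ _ => 1)) /=.
by apply: eq_bigr => v _; rewrite sum1_card /succs -cardE.
Qed.

Lemma sum_preds_leq l : uniq l -> \sum_(v <- l) size (preds v) <= num_edges G.
Proof.
move=> ul; rewrite big_uniq //= -num_edges_sum.
by rewrite [leqRHS](bigID (mem l)) leq_addr.
Qed.

Lemma solve_nil fuel s : solve fuel.+1 [::] s = Some (fun=> false, elapse 2 s).
Proof. by rewrite /= /bind /tick /ticks /ret /= /elapse -addnA. Qed.

(** The work list [T] suffices because no vertex of [Z p] is attractable at the start: one owned by
    [p] has a move inside [Z p], and one owned by the opponent has no edge into [Z (opponent p)], as
    dominions are disjoint. No edge leads from [Z p] into [U], so only vertices of [U] are ever
    attracted. *)
Lemma attract_opponent H T m p (Z : player -> {set G}) s :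
    let U := [set v in H | priority v == m] in
    weak G -> top_block H m -> total_on H ->
    uniq T -> T =i U -> solution (H :\: U) Z ->
    (forall v, pending s v = succs v) ->
    (forall v i, (status s v == Won i) = (v \in Z i) || (i == p) && (v \in U)) ->
  exists acc s', let B := [set v | status s' v == Won (opponent p)] in
    [/\ attract (opponent p) (Won p) T [::] s = Some (acc, s'),
        forall v, pending s' v = succs v,
        forall v, status s' v = status s v \/
          [/\ v \in U, status s v = Won p & status s' v = Won (opponent p)]
      & [/\ dominion (opponent p) H B,
            forall v w, v \in H :\: B -> owner v <> p -> w \in B -> ~~ edge v w,
            total_on (H :\: B)
          & clock s' <= clock s + 6 * weight T + 2]].
Proof.
move=> U wk top tot uT TU [domZ coverZ] pend stat; set q := opponent p.
have qNp : q == p = false by exact: opponent_neq.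
have aNi : Won p != Won q by rewrite /q; case: (p).
have ZHU i : Z i \subset H :\: U by apply/dominion_sub/domZ.
have UH v : v \in U -> v \in H by rewrite inE => /andP[].
have ZNU i v : v \in Z i -> v \notin U by move/(subsetP (ZHU i)); rewrite inE => /andP[].
have ZH i v : v \in Z i -> v \in H by move/(subsetP (ZHU i)); rewrite inE => /andP[].
have below i v w : v \in Z i -> edge v w -> w \in H -> w \in H :\: U.
  by move=> vZ vw wH; apply: (top_block_closed wk top _ wH vw); apply: subsetP vZ.
have inv : attract_inv q (Won p) U H (status s) (pending s) T [::].
  split.
  - by move=> v; rewrite TU.
  - move=> v w wU vw /eqP; rewrite stat eqxx /= => /orP[vZ|//].
    by have := below p v w vZ vw (UH w wU); rewrite inE wU.
  - move=> v /eqP; rewrite stat eqxx TU /= => /orP[vZ|//]; rewrite /attractable.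
    have [r [_ dom dom']] := domZ p; case: eqP => own.
      case/existsP=> w /andP[vw]; rewrite stat qNp orbF => wZ.
      have [|wZp _] := dom' v w vZ _ (below _ _ _ vZ vw (ZH _ _ wZ)) vw.
        by rewrite own; apply/eqP; rewrite qNp.
      by move: (dominion_disjoint wk (domZ p) (domZ q) wZp); rewrite wZ.
    have [|w [vw wZ _]] := dom v vZ; first by move/opponentP: own; rewrite opponentK.
    by case/negP; apply/existsP; exists w; rewrite vw stat wZ.
  - by move=> v w; rewrite pend mem_succs.
  - by move=> v w vw _; rewrite pend mem_succs.
  - by move=> v _; apply: pend.
  - move=> v vH; have [vU|vU] := boolP (v \in U).
      by left; apply/eqP; rewrite stat vU eqxx orbT.
    have vHU : v \in H :\: U by rewrite in_setD vU.
    have /orP[vZ|vZ] := coverZ p v vHU.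
      by left; apply/eqP; rewrite stat vZ.
    by right; apply/eqP; rewrite stat vZ.
  - by move=> v /eqP; rewrite stat eqxx /= => /orP[/ZH|/UH].
  suff -> : [set v | status s v == Won q] = Z q by apply: (dominion_below wk top).
  by apply/setP => v; rewrite inE stat qNp orbF.
have sumU F : \sum_(v in U) F v = \sum_(v <- T) F v.
  by rewrite [RHS]big_uniq //=; apply: eq_bigl => v; rewrite TU.
have sumUa F : \sum_(v in U | status s v == Won p) F v = \sum_(v <- T) F v.
  rewrite -sumU; apply: eq_bigl => v.
  by case vU: (v \in U) => //=; rewrite stat vU eqxx orbT.
have [|acc [s' [run inv' st' cl]]] := attract_loopP aNi
    (fuel := (#|G| + num_edges G).+1) [::] inv.
  rewrite /attract_fuel sumUa ltnS leq_add ?sum_preds_leq //.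
  by rewrite -(card_uniqP uT) max_card.
exists acc, s' => B.
have [_ _ complete _ _ touch stat' game' dom'] := inv'.
have won v : v \in H :\: B -> v \in H /\ status s' v = Won p.
  rewrite inE [v \in B]inE => /andP[vB vH]; split=> //.
  by have [//|eq_q] := stat' v vH; rewrite eq_q eqxx in vB.
(* The work list being empty, nothing in the second subgame is attractable; this yields both its
   closedness and its totality. *)
have stuck v : v \in H :\: B -> ~~ attractable q (Won p) (status s') v.
  by case/won=> _ va; apply/negP => /(complete v va).
have closed v w : v \in H :\: B -> owner v <> p -> w \in B -> ~~ edge v w.
  move=> /stuck + /opponentP own; rewrite /attractable own eqxx inE => nsucc wq.
  by apply: contra nsucc => vw; apply/existsP; exists w; rewrite vw.
split=> // [v|]; first exact: touch.
split=> //.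
  move=> v vHB; have [vH va] := won v vHB; have [own|own] := eqVneq (owner v) p.
    have := stuck v vHB; rewrite /attractable own [p == q]eq_sym qNp negbK.
    case/existsP=> w /andP[vw /eqP wa]; exists w; rewrite // inE (game' w wa) andbT.
    by rewrite inE wa.
  have [w wH vw] := tot v vH; exists w; rewrite // inE wH andbT.
  by apply: contraL vw; apply: closed => //; apply/eqP.
(* The potential is at most 6 per vertex, 3 per outgoing and 4 per incoming edge, plus 2. *)
apply: leq_trans cl _; rewrite -addnA leq_add2l /attract_cost sumUa sumU /=.
rewrite addn0 leq_add2r -size_weight.
have -> : \sum_(v <- T) size (pending s v) = \sum_(v <- T) size (succs v).
  by apply: eq_bigr => v _; rewrite pend.
have : \sum_(v <- T) entry_cost q (status s) v <=
    3 * size T + \sum_(v <- T) size (succs v).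
  apply: (@leq_trans (\sum_(v <- T) (3 + size (succs v)))).
    by apply: leq_sum => v _; rewrite leq_add2l; case: ifP.
  by rewrite big_split /= big_const_seq count_predT iter_addn addn0.
have : \sum_(v <- T) (size (succs v) + 4 * size (preds v) + 3) =
    \sum_(v <- T) size (succs v) + 4 * \sum_(v <- T) size (preds v) + 3 * size T.
  rewrite big_split /= [in LHS]big_split [4 * _]big_distrr /=; congr (_ + _).
  by rewrite big_const_seq count_predT iter_addn addn0.
set E := \sum_(v <- T) entry_cost _ _ _; set F := \sum_(v <- T) (_ + _).
by move: (size T) (\sum_(v <- T) size (succs v)) (\sum_(v <- T) size (preds v)); lia.
Qed.

(** * Specification and cost of the recursive procedure *)

Record solve_pre l s : Prop := SolvePre {
  pre_uniq : uniq l;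
  pre_decreasing : decreasing l;
  pre_total : total_on [set v in l];
  pre_pending : forall v, pending s v = succs v;
  pre_status : forall v, status s v = if v \in l then Free else Out }.

(** Both clock bounds go through one induction: the general one uses the linear one, for subgames
    won by a single player, to pay for the second recursive call. *)
Record solve_post l s (W : player -> bool) s' (Z : player -> {set G}) : Prop := SolvePost {
  post_solution : solution [set v in l] Z;
  post_pending : forall v, pending s' v = succs v;
  post_status : forall v i, (status s' v == Won i) = (v \in Z i);
  post_out : forall v, v \notin l -> status s' v = Out;
  post_result : forall i, W i = (Z i != set0);
  post_clock : clock s' <= clock s + 100 * (priority_count l * weight l) + 2;
  post_clock_dominion : forall i, dominion i [set v in l] [set v in l] ->
    clock s' <= clock s + 30 * weight l + 2 }.

Lemma size_leq_weight l : size l <= weight l.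
Proof. by rewrite -size_weight -addnA leq_addr. Qed.

(** This passes the linear bound on to the first recursive call: edges cannot lead back up into the
    removed block. *)
Lemma dominion_restrict i H m :
    weak G -> top_block H m -> dominion i H H ->
  dominion i (H :\: [set v in H | priority v == m]) (H :\: [set v in H | priority v == m]).
Proof.
move=> wk top [r [_ dom dom']]; exists r; split=> // v.
  move=> vD own; have vH := subsetP (subsetDl _ _) v vD.
  have [w [vw wH pr]] := dom v vH own.
  by exists w; split=> //; apply: (top_block_closed wk top vD).
move=> w vD own wD vw; split=> //.
have sub := subsetP (subsetDl H [set v in H | priority v == m]).
exact: (dom' v w (sub v vD) own (sub w wD) vw).2.
Qed.

(* With [H :\: B] the second subgame: it is empty if one player wins all of [H]. *)
Lemma dominion_total_contra H B i p v w :
    weak G -> dominion i H H -> dominion (opponent p) H B -> dominion p H (H :\: B) ->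
  v \in B -> w \in H :\: B -> False.
Proof.
move=> wk domi domB domHB vB wHB.
have [eq_i|/eqP/opponentP eq_i] := eqVneq i p; last first.
  rewrite eq_i in domi; have := dominion_disjoint wk domHB domi wHB.
  by rewrite (subsetP (subsetDl _ _) _ wHB).
rewrite eq_i in domi; have := dominion_disjoint wk domi domB.
by move/(_ v (subsetP (dominion_sub domB) v vB)); rewrite vB.
Qed.

(** Here [w] and [w'] are the weights of the top block and of the rest, and [n] counts the
    priorities of the rest; the work of one level is charged to [w + w']. *)
Lemma weight_step (n w w' t t' : nat) :
    t' <= t + 100 * (w + w' + n * w') + 2 ->
  t' <= t + 100 * (n.+1 * (w + w')) + 2.
Proof. by move/leq_trans; apply; rewrite leq_add2r leq_add2l leq_mul2l /=; nia. Qed.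

(** The proof follows the memory through one call: [s2] precedes the first recursive call, [s4]
    follows it with the top block given to [p], and [s5] follows the opponent's attractor. *)
Lemma solveP fuel l s : weak G -> solve_pre l s -> size l < fuel ->
  exists W s' Z, solve fuel l s = Some (W, s') /\ solve_post l s W s' Z.
Proof.
move=> wk; elim: fuel l s => // fuel IHf [|x l] s pre lt_fuel.
  rewrite solve_nil; exists (fun=> false), (elapse 2 s), (fun=> set0).
  case: pre => _ _ _ pend stat; split=> //; split=> //= [|v i|i||i _].
  - have -> : [set v in [::]] = set0 :> {set G} by apply/setP => v; rewrite !inE.
    exact: solution0.
  - by rewrite stat inE.
  - by rewrite eqxx.
  - by rewrite leq_add2r leq_addr.
  by rewrite leq_add2r leq_addr.
case: pre => ul dec tot pend stat.
set L := x :: l in ul dec tot stat lt_fuel *; set H := [set v in L] in tot *.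
set m := priority x; set p := parity_player m; set q := opponent p.
have qNp : q == p = false by exact: opponent_neq.
have xL : x \in L by exact: mem_head.
have HE v : (v \in H) = (v \in L) by rewrite in_set.
have leL v : v \in L -> priority v <= m.
  rewrite inE => /predU1P[->//|vl]; move: dec; rewrite /decreasing /= => /andP[+ _].
  by move/allP/(_ v vl).
have top : top_block H m by move=> v; rewrite HE; apply: leL.
set T := [seq v <- L | priority v == m]; set D := [seq v <- L | priority v != m].
set U := [set v in H | priority v == m].
have [takeT dropD] := find_decreasing dec leL; rewrite -/T -/D in takeT dropD.
have uT : uniq T by rewrite filter_uniq.
have uA : uniq (rev T) by rewrite rev_uniq.
have UE v : (v \in U) = (v \in L) && (priority v == m) by rewrite in_set HE.
have TU v : (v \in T) = (v \in U) by rewrite mem_filter UE andbC.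
have AU : rev T =i U by move=> v; rewrite mem_rev TU.
have UH v : v \in U -> v \in L by rewrite UE => /andP[].
have DE v : (v \in D) = (v \in L) && (v \notin U).
  by rewrite mem_filter UE; case: (v \in L); rewrite ?andbF ?andbT.
have setD : [set v in D] = H :\: U by apply/setP => v; rewrite in_setD HE in_set DE andbC.
have xT : x \in T by rewrite mem_filter eqxx.
have wLE : weight L = weight T + weight D by rewrite weight_filter.
have ltT : 0 < size T by case: (T) xT.
have sizeTD : size T + size D = size L by rewrite !size_filter count_predC.
have lt_D : size D < fuel.
  by rewrite -ltnS (leq_trans _ lt_fuel) // ltnS -sizeTD -add1n leq_add2r.
have countL := priority_count_top (m := m) xL (erefl _); rewrite -/D in countL.
have sumA F : \sum_(v <- rev T) F v = \sum_(v <- T) F v :> nat by rewrite big_rev.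
have seekx : seek Free L (elapse 1 s) = Some (L, elapse 2 s).
  by rewrite seekE /= stat xL /= /elapse /= -addnA.
have freeL v : v \in L -> status (elapse 2 s) v = Free by move=> vL; rewrite /= stat vL.
have topE := take_topE m p [::] ul freeL; rewrite takeT dropD -/(rev T) in topE.
have sizeT : find (fun v => priority v != m) L = size T.
  by rewrite -takeT size_takel ?find_size.
rewrite sizeT in topE.
rewrite [solve _ _ _]/= (bindE (s' := elapse 1 s) (x := tt) _ (erefl _)).
rewrite (bindE _ seekx) /= -/m -/p (bindE _ topE) /= (bindE _ (push_predsE _ _ _)).
set work := foldl _ _ _; rewrite -/q.
set s1 := elapse _ _.
have stat1 v : status s1 v = if v \in T then Won p else if v \in L then Free else Out.
  by rewrite ffunE stat.
(* No lower vertex has an edge into the block, and the block itself is no longer free; so the first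
   attractor adds nothing. *)
have work1 v : v \in work -> status s1 v != Free.
  rewrite mem_push_preds orbF => /hasP[u]; rewrite mem_rev => uT' vu.
  rewrite stat1; case: ifP => // /negbT; rewrite TU => vU; case: ifP => // vL.
  move: uT'; rewrite TU => uU; have vHU : v \in H :\: U by rewrite in_setD vU HE.
  have := top_block_closed wk top vHU _ vu; rewrite -/U in_setD uU /=.
  by rewrite HE UH // => /(_ isT).
have sizework : size work = \sum_(v <- T) size (preds v).
  by rewrite size_push_preds addn0 sumA.
rewrite (bindE _ (attract_loop_idle _ _ work1 _)); last first.
  by rewrite sizework ltnS (leq_trans (sum_preds_leq uT)) ?leq_addl.
rewrite (bindE _ (put_allE _ _ _)).
set s2 := Memory _ _ _.
have pre2 : solve_pre D s2.
  split.
  - by rewrite filter_uniq.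
  - exact: pairwise_filter.
  - rewrite setD /U -(attr_top p wk top tot); exact: total_on_attr.
  - by move=> v; apply: pend.
  move=> v; rewrite ffunE mem_rev TU stat1 TU DE.
  by case vU: (v \in U) => /=; rewrite ?andbF ?andbT.
have [W1 [s3 [Z1 [run3 post3]]]] := IHf D s2 pre2 lt_D.
rewrite (bindE _ run3) (bindE _ (put_allE _ _ _)).
set s4 := Memory _ _ _.
have sumT : \sum_(v <- T) (size (preds v)).+2 =
    \sum_(v <- T) size (preds v) + 2 * size T.
  under eq_bigr do rewrite -addn2.
  by rewrite big_split /= big_const_seq count_predT iter_addn addn0.
have wT := size_weight T.
(* This stage takes [4 * size T + 7] ticks and 2 per incoming edge; [T] being nonempty, the 7 is
   absorbed. *)
have clock2 : clock s2 <= clock s + 11 * weight T.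
  rewrite /s2 /= size_rev sizework sumA sumT; move: wT ltT.
  move: (size T) (\sum_(_ <- T) _) (\sum_(_ <- T) _) (weight T) (clock s).
  by clear; lia.
have clock4 : clock s4 <= clock s3 + 2 * weight T.
  rewrite /= size_rev leq_add2l; move: wT ltT.
  move: (size T) (\sum_(_ <- T) _) (\sum_(_ <- T) _) (weight T).
  by clear; lia.
have [sol1 pend3 stat3 out3 res1 clock3 clock3'] := post3.
rewrite setD in sol1 clock3'.
have clockD i : dominion i H H -> clock s3 <= clock s2 + 30 * weight D + 2.
  by move/(dominion_restrict wk top)/clock3'.
have ZHU i v : v \in Z1 i -> v \in H :\: U.
  by apply: subsetP; apply: dominion_sub (sol1.1 i).
have stat4 v i : (status s4 v == Won i) = (v \in Z1 i) || (i == p) && (v \in U).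
  rewrite ffunE mem_rev TU; have [vU|vU] := boolP (v \in U); last first.
    by rewrite andbF orbF stat3.
  have -> : (v \in Z1 i) = false.
    by apply/negP => /ZHU; rewrite in_setD vU.
  by rewrite andbT /= eq_sym; case: (i); case: (p).
have out4 v : v \notin L -> status s4 v = Out.
  move=> vL; rewrite ffunE mem_rev TU; case: ifP => [/UH vL'|_].
    by rewrite vL' in vL.
  by apply: out3; rewrite DE negb_and vL.
have xU : x \in U by rewrite -TU.
case W1q: (W1 q); last first.
  exists (eq_op^~ p), s4, (fun i => if i == p then U :|: Z1 p else set0).
  have Z1q : Z1 q = set0 by apply/eqP; move: W1q; rewrite res1 => /negbFE.
  split=> //; split=> //.
  - exact: solution_top.
  - move=> v i; rewrite stat4; have [->|/eqP/opponentP ->] := eqVneq i p.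
      by rewrite in_setU orbC.
    by rewrite -/q Z1q in_set0.
  - move=> i; case: (i == p); last by rewrite eqxx.
    by apply/esym/set0Pn; exists x; rewrite in_setU xU.
  - rewrite countL wLE; apply: weight_step; move: clock2 clock3 clock4.
    move: (priority_count D * _).
    move: (clock s) (clock s2) (clock s3) (clock s4) (weight T) (weight D).
    by clear; lia.
  move=> i /clockD; rewrite wLE; move: clock2 clock4.
  move: (clock s) (clock s2) (clock s3) (clock s4) (weight T) (weight D).
  by clear; lia.
have [acc [s5 [run5 pend5 stat5 [dom5 closed5 tot5 clock5]]]] :=
  attract_opponent wk top tot uA AU sol1 (pend3 : forall v, pending s4 v = _) stat4.
rewrite -/q in run5 stat5 dom5.
set B := [set v | _] in dom5 closed5 tot5.
rewrite /= (bindE _ run5) (bindE _ (seekE _ _ _)) /=.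
set restA := drop _ _.
set s6 := elapse _ s5.
have restE : (restA != [::]) = has (fun v => status s5 v == Won p) T.
  by rewrite -size_eq0 size_drop subn_eq0 -ltnNge -has_find has_rev.
have clock6 : clock s6 <= clock s3 + 12 * weight T.
  have lek := find_size (fun v => status s5 v == Won p) (rev T).
  have wA : weight (rev T) = weight T by apply: sumA.
  rewrite size_rev in lek; rewrite wA in clock5.
  rewrite /= {restA restE s6}; move: clock4 clock5 lek ltT (size_leq_weight T).
  move: (find _ _) (clock s3) (clock s4) (clock s5) (weight T) (size T).
  by clear; lia.
have won5 v : v \in L -> (status s5 v == Won p) = (v \notin B).
  move=> vL; rewrite in_set; suff [->|->] : status s5 v = Won p \/ status s5 v = Won q.
  - by rewrite eqxx eq_sym; apply/esym/eqP => -[]; rewrite /q; case: (p).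
  - by rewrite eqxx; apply/eqP => -[]; rewrite /q; case: (p).
  have [->|[_ _ ->]] := stat5 v; last by right.
  have [vU|vU] := boolP (v \in U).
    by left; apply/eqP; rewrite stat4 vU eqxx orbT.
  have vHU : v \in H :\: U by rewrite in_setD vU HE.
  by have /orP[vZ|vZ] := sol1.2 p v vHU; [left|right]; apply/eqP; rewrite stat4 vZ.
have BL v : v \in B -> v \in L by move/(subsetP (dominion_sub dom5)); rewrite HE.
have HBE v : (v \in H :\: B) = (v \in L) && (status s5 v == Won p).
  by rewrite in_setD HE andbC; case vL: (v \in L) => //=; rewrite won5.
have Z1p v : v \in Z1 p -> v \in H :\: B.
  move=> vZ; have := ZHU p v vZ; rewrite in_setD HE HBE => /andP[vU vL].
  have [->|[vU' _ _]] := stat5 v; last by rewrite vU' in vU.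
  by rewrite vL stat4 vZ.
have Z1q v : v \in Z1 q -> v \in B.
  move=> vZ; rewrite in_set; have [->|[_ _ ->]] := stat5 v; last by [].
  by rewrite stat4 vZ.
have [v0 v0Z] : exists v, v \in Z1 q by apply/set0Pn; rewrite -res1.
have v0B := Z1q _ v0Z.
have HBU v : v \in H :\: B -> (v \in U) || (v \in Z1 p).
  move=> vHB; have [//|vU] := boolP (v \in U).
  move: vHB; rewrite in_setD => /andP[vB vH].
  have vHU : v \in H :\: U by rewrite in_setD vU.
  by have /orP[//|/Z1q] := sol1.2 p v vHU; rewrite (negPf vB).
(* The second subgame holds only block vertices and vertices won by [p] in the first call, so [p]
   wins all of it and the linear bound applies. *)
have domp : dominion p (H :\: B) (H :\: B).
  apply: (dominion_top wk top (subsetDl _ _) tot5 (sol1.1 p)).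
    by apply/subsetP => v /HBU; rewrite in_setU.
  exact/subsetP.
have dompH : dominion p H (H :\: B).
  apply: dominion_widen (subsetDl _ _) domp _ => v w vHB own wH vw.
  by rewrite in_setD wH andbT; apply: contraL vw; apply: closed5.
(* The test of the program holds exactly when the second subgame is nonempty. *)
case: ifP => cnd.
  have [w0 w0HB] : exists w, w \in H :\: B.
    case/orP: cnd; first by rewrite res1 => /set0Pn[w /Z1p]; exists w.
    by rewrite restE => /hasP[w]; rewrite TU => /UH wL st_w; exists w; rewrite HBE wL.
  have reopenL := reopenE p s6 ul; rewrite -/q in reopenL.
  set S1 := [seq v <- L | status s6 v == Won p] in reopenL.
  set S2 := [seq v <- L | status s6 v == Won q] in reopenL.
  set s7 := Memory _ _ _ in reopenL.
  rewrite (bindE _ reopenL) /=.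
  have S1E v : (v \in S1) = (v \in H :\: B) by rewrite mem_filter HBE andbC.
  have setS1 : [set v in S1] = H :\: B by apply/setP => v; rewrite in_set S1E.
  have S2E v : (v \in S2) = (v \in B).
    rewrite mem_filter [v \in B]in_set andbC /=.
    by case vL: (v \in L) => //=; apply/esym; apply: contraFF vL => vq; rewrite BL ?in_set.
  have pre7 : solve_pre S1 s7.
    split.
    - by rewrite filter_uniq.
    - exact: pairwise_filter.
    - by rewrite setS1.
    - by move=> v; apply: pend5.
    move=> v; rewrite S1E HBE ffunE /=.
    case: ifP => /= vL.
      rewrite (negPf vL) /=; have [->|[vU _ _]] := stat5 v; first exact: out4.
      by move: vL; rewrite UH.
    rewrite (negbFE vL); case: ifP => //= notp.
    have := won5 v (negbFE vL); rewrite notp => /esym/negbFE.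
    by rewrite in_set => ->.
  (* The list has become shorter because [v0], won by the opponent, is missing. *)
  have lt_S1 : size S1 < fuel.
    rewrite -ltnS (leq_trans _ lt_fuel) // ltnS size_filter ltn_neqAle count_size andbT.
    rewrite -all_count; apply/allPn; exists v0; first exact: BL.
    by rewrite /= won5 ?BL // v0B.
  have [W2 [s8 [Z2 [run8 post8]]]] := IHf S1 s7 pre7 lt_S1.
  rewrite (bindE _ run8) (bindE _ (put_allE _ _ _)).
  set s9 := Memory _ _ _.
  have [sol2 pend8 stat8 out8 res2 _ clock8] := post8.
  rewrite setS1 in sol2 clock8; have {}clock8 := clock8 p domp.
  exists (fun i => if i == p then W2 p else true), s9.
  exists (fun i => if i == p then Z2 p else Z2 q :|: B).
  have Z2HB i v : v \in Z2 i -> v \notin B.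
    by move/(subsetP (dominion_sub (sol2.1 i))); rewrite in_setD => /andP[].
  split=> //; split=> //.
  - exact: (solution_attr dom5 closed5 sol2).
  - move=> v i; rewrite ffunE S2E; have [->|/eqP/opponentP ->] := eqVneq i p.
      case: ifP => vB; last by rewrite stat8.
      have -> : (v \in Z2 p) = false by apply/negP => /Z2HB; rewrite vB.
      by rewrite /q; case: (p).
    by rewrite -/q in_setU orbC; case: (v \in B); rewrite ?eqxx ?stat8.
  - move=> v vL; rewrite ffunE S2E; case: ifP => [/BL|_]; first by rewrite (negPf vL).
    by apply: out8; rewrite S1E HBE (negPf vL).
  - move=> i; case: (i == p); first exact: res2.
    by apply/esym/set0Pn; exists v0; rewrite in_setU v0B orbT.
  - have sizeS2 : size S2 <= size L by rewrite size_filter count_size.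
    have wS1 : weight S1 <= weight L.
      by rewrite -[leqRHS](weight_filter (fun v => status s6 v == Won p)) leq_addr.
    have clock7 : clock s7 = clock s6 + (size L).+1 by [].
    have clock9 : clock s9 = clock s8 + (size S2).+1 by [].
    rewrite clock9 countL wLE; apply: weight_step; rewrite wLE in wS1.
    have := size_leq_weight L; rewrite wLE; move: (size_leq_weight T) ltT sizeS2 wS1.
    rewrite clock7 in clock8; clear clock9 clock7; move: clock2 clock3 clock6 clock8.
    move: (priority_count D * weight D) (clock s) (clock s2) (clock s3) (clock s6) (clock s8).
    move: (weight T) (weight D) (weight S1) (size L) (size T) (size S2).
    by clear; lia.
  (* The linear bound is vacuous here: [v0] and [w0] are won by different players. *)
  move=> i domi; exfalso.
  exact: (dominion_total_contra wk domi dom5 dompH v0B w0HB).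
(* Even the call on the empty list needs one unit of fuel. *)
have [fuel' fuelE] : exists fuel', fuel = fuel'.+1.
  by exists fuel.-1; rewrite prednK // (leq_ltn_trans _ lt_D).
rewrite /= {1}/bind /ret /= {1}fuelE (bindE _ (solve_nil _ _)).
rewrite /bind /tick /ticks /=; set s7 := Memory _ _ _.
have HB0 : H :\: B = set0.
  apply/setP => v; rewrite in_set0; apply/negP => vHB.
  move/negbT: cnd; rewrite negb_or restE => /andP[/negP Z1p0 /hasPn noT].
  have /orP[vU|vZ] := HBU v vHB; last first.
    by apply: Z1p0; rewrite res1; apply/set0Pn; exists v.
  by move: vHB; rewrite HBE -TU in vU *; rewrite (negPf (noT v vU)) andbF.
have stat7 v : status s7 v = status s5 v by [].
have sol2 := solution_attr dom5 closed5.
exists (fun i => if i == p then false else true), s7.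
exists (fun i => if i == p then set0 else set0 :|: B).
split=> //; split=> //.
- by apply: sol2 (fun=> set0) _; rewrite HB0; apply: solution0.
- move=> v i; rewrite stat7; have [->|/eqP/opponentP ->] := eqVneq i p.
    have := HBE v; rewrite HB0 in_set0.
    case vL: (v \in L) => /=; first by move=> <-.
    move=> _; have [->|[/UH]] := stat5 v; last by rewrite vL.
    by rewrite out4 ?vL.
  by rewrite set0U in_set.
- move=> v vL; rewrite stat7; have [->|[/UH]] := stat5 v; first exact: out4.
  by rewrite (negPf vL).
- move=> i; case: (i == p); first by rewrite eqxx.
  by apply/esym/set0Pn; exists v0; rewrite in_setU v0B orbT.
- rewrite countL wLE; apply: weight_step.
  have clock7 : clock s7 = clock s6 + 3 by rewrite /= -addnA.
  rewrite clock7 {clock7}; move: clock2 clock3 clock6 ltT (size_leq_weight T).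
  move: (priority_count D * weight D) (clock s) (clock s2) (clock s3) (clock s6).
  move: (weight T) (weight D) (size T).
  by clear; lia.
move=> i /clockD {}clockD; rewrite wLE.
have clock7 : clock s7 = clock s6 + 3 by rewrite /= -addnA.
rewrite clock7 {clock7}; move: clock2 clockD clock6 ltT (size_leq_weight T).
move: (clock s) (clock s2) (clock s3) (clock s6) (weight T) (weight D) (size T).
by clear; lia.
Qed.

(** * Sorting the vertices by buckets *)

Definition bucketed (bs : seq (nat * seq G)) : bool :=
  pairwise (fun m n => n < m) (unzip1 bs) &&
  all (fun b => all (fun v => priority v == b.1) b.2) bs.

(** The set of keys is tracked because distinct keys that are priorities of vertices bound the
    number of buckets, and with it the cost of later insertions. *)
Lemma insert_bucketP v bs s : exists bs' n,
  [/\ insert_bucket v bs s = Some (bs', elapse n s), n <= (size bs).+1,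
      bucketed bs -> bucketed bs',
      perm_eq (flatten (unzip2 bs')) (v :: flatten (unzip2 bs))
    & unzip1 bs' =i priority v :: unzip1 bs].
Proof.
elim: bs s => [|b bs IHbs] s /=.
  exists [:: (priority v, [:: v])], 1; split=> //.
  by rewrite /bucketed /= eqxx.
rewrite {1}/bind /tick /ticks /=; case: ifP => [/eqP prv|prv].
  exists ((b.1, v :: b.2) :: bs), 1; split=> //; first by rewrite /bucketed /= prv eqxx.
  by move=> k; rewrite !inE prv orbA orbb.
case: ifP => [lt_b|ge_b].
  exists ((priority v, [:: v]) :: b :: bs), 1; split=> //.
  rewrite /bucketed /= eqxx lt_b => /andP[/andP[below ->] ->].
  rewrite below !andbT /=; apply/allP => k kbs.
  exact: ltn_trans (allP below k kbs) lt_b.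
have [bs' [n [run len buck perm keys]]] := IHbs (elapse 1 s).
exists (b :: bs'), n.+1; split.
- by rewrite (bindE _ run) /ret /elapse /= -addnA.
- by rewrite ltnS.
- rewrite /bucketed /= => /andP[/andP[/allP below pw] /andP[-> homog]].
  have /buck/andP[-> ->] : bucketed bs by rewrite /bucketed pw.
  rewrite !andbT; apply/allP => k; rewrite keys inE => /predU1P[->|]; last exact: below.
  by rewrite ltn_neqAle prv leqNgt ge_b.
- rewrite -(perm_cat2l b.2) in perm; apply: perm_trans perm _.
  by rewrite /= -cat1s perm_catCA.
by move=> k; rewrite /= !inE keys inE orbCA.
Qed.

Lemma size_bucketed bs : bucketed bs ->
  {subset unzip1 bs <= codom (@priority G)} -> size bs <= num_priorities G.
Proof.
case/andP=> pw _ sub; rewrite -(size_map (@fst nat (seq G))) uniq_leq_size //.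
  by apply: pairwise_uniq pw => n; rewrite ltnn.
by move=> k; rewrite mem_undup; apply: sub.
Qed.

Lemma make_bucketsP l bs s : bucketed bs ->
    {subset unzip1 bs <= codom (@priority G)} ->
  exists bs' n,
    [/\ make_buckets l bs s = Some (bs', elapse n s),
        n <= size l * (num_priorities G + 2) + 1,
        bucketed bs', size bs' <= num_priorities G
      & perm_eq (flatten (unzip2 bs')) (l ++ flatten (unzip2 bs))].
Proof.
elim: l bs s => [|v l IHl] bs s buck sub /=.
  by exists bs, 1; split=> //; apply: size_bucketed.
rewrite {1}/bind /tick /ticks /=.
have [bs1 [n1 [run1 len1 buck1 perm1 keys1]]] := insert_bucketP v bs (elapse 1 s).
rewrite (bindE _ run1).
have [||bs2 [n2 [run2 len2 buck2 size2 perm2]]] := IHl bs1 (elapse n1 (elapse 1 s)).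
- exact: buck1.
- by move=> k; rewrite keys1 inE => /predU1P[->|/sub//]; apply: codom_f.
exists bs2, (1 + n1 + n2); split=> //.
- by rewrite run2 /elapse /= !addnA.
- have := size_bucketed buck sub; move: len1 len2; rewrite mulSn.
  by clear; lia.
rewrite -(perm_cat2l l) in perm1.
by apply/(perm_trans perm2)/(perm_trans perm1); rewrite -cat1s perm_catCA.
Qed.

Lemma appendE l1 l2 s : append l1 l2 s = Some (l1 ++ l2, elapse (size l1).+1 s).
Proof.
elim: l1 s => [|v l1 IHl] s /=; first by [].
rewrite {1}/bind /tick /ticks /= (bindE _ (IHl _)) /ret /elapse /=.
by congr (Some (_, Memory _ _ _)); lia.
Qed.

Lemma concatE bs s :
  concat bs s = Some (flatten (unzip2 bs),
                      elapse (size (flatten (unzip2 bs)) + 2 * size bs).+1 s).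
Proof.
elim: bs s => [|b bs IHbs] s /=; first by [].
rewrite {1}/bind /tick /ticks /= (bindE _ (IHbs _)) appendE /elapse /= size_cat.
by congr (Some (_, Memory _ _ _)); lia.
Qed.

Lemma bucketed_decreasing bs : bucketed bs -> decreasing (flatten (unzip2 bs)).
Proof.
elim: bs => // b bs IHbs; rewrite /bucketed /=.
case/andP=> /andP[/allP below pw] /andP[/allP homog homogs].
rewrite /decreasing pairwise_cat; apply/and3P; split.
- apply/allrelP => v w /homog/eqP prv /flattenP[_ /mapP[b' b'bs ->] wb'].
  have /eqP -> := allP (allP homogs b' b'bs) w wb'.
  by rewrite prv ltnW // below // map_f.
- have {}homog : {in b.2, forall v, priority v = b.1} by move=> v /homog/eqP.
  elim: (b.2) homog => //= v l IHl homog; rewrite IHl; last first.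
    by move=> w wl; apply: homog; rewrite inE wl orbT.
  rewrite andbT; apply/allP => w wl.
  by rewrite !homog ?mem_head // inE wl orbT.
by apply: IHbs; rewrite /bucketed pw.
Qed.

(** * Correctness and running time of the whole program *)

Lemma run_zielonkaP : weak G -> exists W t,
  [/\ run_zielonka G = Some (W, t), W =1 zielonka G
    & 0 < #|G| -> t <= 300 * (num_priorities G * (#|G| + num_edges G))].
Proof.
move=> wk; rewrite /run_zielonka /main.
have [//|//|bs [n [run len buck size_bs perm]]] := make_bucketsP (enum G) (bs := [::])
  (elapse (#|G| + num_edges G) (initial_memory G)).
rewrite /= cats0 in perm.
set l := flatten (unzip2 bs) in perm.
rewrite {1}/bind {1}/ticks (bindE _ run) (bindE _ (concatE _ _)) -/l.
set s := elapse _ (elapse _ _).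
have lG v : v \in l by rewrite (perm_mem perm) mem_enum.
have setl : [set v in l] = [set: G] by apply/setP => v; rewrite in_set in_setT lG.
have size_l : size l = #|G| by rewrite (perm_size perm) -cardE.
have pre : solve_pre l s.
  split.
  - by rewrite (perm_uniq perm) enum_uniq.
  - exact: bucketed_decreasing.
  - by rewrite setl; apply: total_on_setT.
  - by move=> v; rewrite ffunE.
  by move=> v; rewrite ffunE lG.
have [|W [s' [Z [runs post]]]] := solveP (fuel := #|G|.+1) wk pre; first by rewrite size_l.
rewrite (bindE _ runs) /ret.
eexists _, _; split; first by [].
  have solZ : solution [set: G] Z by rewrite -setl; apply: post_solution post.
  move=> i; rewrite -(solution_unique wk solZ (solution_zielonka wk) i).
  by apply/setP => v; rewrite in_set (post_status post).
move=> G_gt0; apply: leq_trans (post_clock post) _.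
have -> : priority_count l = num_priorities G.
  apply/perm_size/uniq_perm; rewrite ?undup_uniq // => k; rewrite !mem_undup.
  by rewrite codomE; apply: perm_mem; apply: perm_map.
(* Each edge is counted at both of its ends. *)
have -> : weight l = #|G| + 2 * num_edges G.
  rewrite -size_weight size_l mul2n -addnn addnA; congr (_ + _ + _).
    by rewrite -num_edges_sum_succs (perm_big _ perm) big_enum.
  by rewrite -num_edges_sum (perm_big _ perm) big_enum.
(* A nonempty game has a priority, so the terms without this factor are absorbed by the product. *)
have d_gt0 : 0 < num_priorities G.
  have /card_gt0P[v _] := G_gt0.
  have : priority v \in undup (codom (@priority G)) by rewrite mem_undup codom_f.
  by rewrite /num_priorities; case: (undup _).
(* The recursion contributes at most 200 per edge and priority, and bucket insertion
   [#|G| * (num_priorities G + 2) + 1]; the constant 300 also covers the rest. *)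
move: len size_bs d_gt0 G_gt0; rewrite /= size_l -cardE.
move: (num_priorities G) (num_edges G) (size bs) #|G|.
by clear; nia.
Qed.

End Machine.

Theorem theorem1 :
  exists c : nat, forall G : parity_game, weak G ->
    (forall (i : player) (v : G), v \in zielonka G i <-> won_by i v) /\
    zielonka G diamond :|: zielonka G box = [set: G] /\
    zielonka G diamond :&: zielonka G box = set0 /\
    exists (W : player -> {set G}) (t : nat),
      run_zielonka G = Some (W, t) /\
      (forall i : player, W i = zielonka G i) /\
      (0 < #|G| -> t <= c * (num_priorities G * (#|G| + num_edges G))).
Proof.
exists 300 => G wk; split; first by move=> i v; apply: zielonka_correct.
split; first exact: zielonka_cover.
split; first exact: zielonka_disjoint.
by have [W [t [run WE tE]]] := run_zielonkaP wk; exists W, t.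
Qed.
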